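(* Let $\Omega\subset\mathbb{R}^n$ be a strictly convex connected domain containing the origin $\mathbf 0$, and let $(\Omega,F)$ be a projectively flat Finsler manifold of constant flag curvature $\mathbf{K}$ with projective factor $P$. Then for any pair of distinct points $x_1,x_2\in\Omega$, the distance $d_F(x_1,x_2)$ is given by $$d_F(x_1,x_2)=\begin{cases}\dfrac{F(x_1,x_2-x_1)}{1-P(x_1,x_2-x_1)}, & \text{if }\mathbf{K}=0;\\[10pt] \ln\sqrt{\dfrac{1-P(x_1,x_2-x_1)+F(x_1,x_2-x_1)}{1-P(x_1,x_2-x_1)-F(x_1,x_2-x_1)}}, & \text{if }\mathbf{K}=-1;\\[10pt] \arctan\dfrac{F^2(x_1,x_2-x_1)+P^2(x_1,x_2-x_1)-P(x_1,x_2-x_1)}{F(x_1,x_2-x_1)}+\arctan\dfrac{P(x_1,x_2-x_1)}{F(x_1,x_2-x_1)}, & \text{if }\mathbf{K}=1.\end{cases}$$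
   Context: Throughout $n\ge 2$; $T\Omega$ is identified with $\Omega\times\mathbb{R}^n$ with coordinates $(x^i,y^i)$; subscripts $x^i,y^i$ denote partial derivatives and repeated indices are summed. A Minkowski norm on $\mathbb{R}^n$ is a function $\psi\ge 0$, vanishing only at $\mathbf 0$, with $\psi(\alpha y)=\alpha\psi(y)$ for $\alpha>0$, smooth on $\mathbb{R}^n\setminus\{\mathbf 0\}$, such that the matrix $([\psi^2]_{y^iy^j}(y))$ is positive definite for every $y\neq\mathbf 0$ (no symmetry $\psi(-y)=\psi(y)$ is required). A Finsler metric on $\Omega$ is a function $F=F(x,y)$ on $T\Omega$, smooth on $T\Omega\setminus\{0\}$, such that $F(x,\cdot)$ is a Minkowski norm for each $x$. The length of a piecewise smooth curve $c:[0,1]\to\Omega$ is $L_F(c)=\int_0^1F(c,c')\,dt$, and $d_F(x_1,x_2)$ is the infimum of $L_F(c)$ over piecewise smooth curves in $\Omega$ from $x_1$ to $x_2$ (in general $d_F$ is not symmetric). Geodesics are the constant-speed curves satisfying $\ddot\gamma^i+2G^i(\gamma,\dot\gamma)=0$, where $G^i=\frac14 g^{ij}\{[F^2]_{x^ky^j}y^k-[F^2]_{x^j}\}$ and $(g^{ij})$ is the inverse of $g_{ij}=\frac12[F^2]_{y^iy^j}$. $F$ is projectively flat if the images of all geodesics are (contained in) straight lines; equivalently $G^i=P\,y^i$, where $P(x,y)=\frac{y^kF_{x^k}(x,y)}{2F(x,y)}$ is the projective factor. The flag curvature $\mathbf K$ is the usual Finsler generalization of sectional curvature; for a projectively flat $F$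 it equals $\mathbf{K}(x,y)=\frac{P^2-y^iP_{x^i}}{F^2}$. *)

(* Defs.v *)
From HB Require Import structures.
From mathcomp Require Import all_boot all_order all_algebra.
From mathcomp Require Import all_classical all_reals all_analysis.

Set Implicit Arguments.
Unset Strict Implicit.
Unset Printing Implicit Defensive.

Import Order.TTheory GRing.Theory Num.Theory.
Import numFieldNormedType.Exports.

Local Open Scope classical_set_scope.
Local Open Scope ring_scope.

Section Smooth.
Context {R : realType} {V W : normedModType R}.

(* For V finite-dimensional and U open this is the usual C^k class: all iterated
   directional derivatives up to order k exist and are continuous on U. *)
Fixpoint Ck (k : nat) (U : set V) (f : V -> W) : Prop :=
  (forall x, U x -> {for x, continuous f}) /\
  (if k is k'.+1 then
     forall v : V, (forall x, U x -> derivable f x v) /\ Ck k' U ('D_v f)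
   else True).

Definition smooth (U : set V) (f : V -> W) : Prop := forall k, Ck k U f.

End Smooth.

Section Finsler.
Context {R : realType} {n : nat}.
Local Notation vec := 'rV[R]_n.

Implicit Types (Omega : set vec) (F : vec -> vec -> R) (x y u v : vec).

(* The boundary contains no segment: the open segment between two distinct
   points of the closure is interior. *)
Definition strictly_convex Omega : Prop :=
  forall x y, closure Omega x -> closure Omega y -> x != y ->
  forall t : R, 0 < t < 1 -> interior Omega ((1 - t) *: x + t *: y).

Definition posdefmx (A : 'M[R]_n) : Prop :=
  forall v, v != 0 -> 0 < (v *m A *m v^T) 0 0.

Definition partial (i : 'I_n) (f : vec -> R) : vec -> R :=
  'D_(delta_mx 0 i : vec) f.

Definition hessian (f : vec -> R) (y : vec) : 'M[R]_n :=
  \matrix_(i, j) partial j (partial i f) y.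

Definition minkowski_norm (psi : vec -> R) : Prop :=
  [/\ forall y, 0 <= psi y,
      forall y, psi y = 0 <-> y = 0,
      forall (a : R) y, 0 < a -> psi (a *: y) = a * psi y,
      smooth [set y | y != 0] psi &
      forall y, y != 0 -> posdefmx (hessian (fun w => psi w ^+ 2) y)].

(* Functions on T Omega are curried total functions vec -> vec -> R of (x, y);
   their values for x outside Omega are irrelevant. *)
Definition finsler_metric Omega F : Prop :=
  smooth [set z : vec * vec | Omega z.1 /\ z.2 != 0] (fun z => F z.1 z.2) /\
  (forall x, Omega x -> minkowski_norm (F x)).

Definition dx (k : 'I_n) (f : vec -> vec -> R) : vec -> vec -> R :=
  fun x y => partial k (f ^~ y) x.

Definition dy (k : 'I_n) (f : vec -> vec -> R) : vec -> vec -> R :=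
  fun x y => partial k (f x) y.

Definition sqF F : vec -> vec -> R := fun x y => F x y ^+ 2.

Definition fundamental_tensor F x y : 'M[R]_n :=
  \matrix_(i, j) (2^-1 * dy j (dy i (sqF F)) x y).

Definition spray_coef F (i : 'I_n) : vec -> vec -> R := fun x y =>
  4^-1 * \sum_j invmx (fundamental_tensor F x y) i j *
    ((\sum_k dy j (dx k (sqF F)) x y * y 0 k) - dx j (sqF F) x y).

(* Requiring positive speed excludes constant curves, at which G^i would be
   evaluated on the zero section. *)
Definition geodesic Omega F (I : set R) (gamma : R -> vec) : Prop :=
  [/\ open I /\ is_interval I,
      forall t, I t -> Omega (gamma t),
      exists2 s : R, 0 < s & forall t, I t -> F (gamma t) (derive1 gamma t) = s,
      forall t, I t -> derivable gamma t 1 /\ derivable (derive1 gamma) t 1 &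
      forall t, I t -> forall i,
        (derive1 (derive1 gamma) t) 0 i + 2 * spray_coef F i (gamma t) (derive1 gamma t) = 0].

Definition projectively_flat Omega F : Prop :=
  forall (I : set R) (gamma : R -> vec), geodesic Omega F I gamma ->
  exists p v : vec, v != 0 /\
    forall t, I t -> exists s : R, gamma t = p + s *: v.

Definition projective_factor F x y : R :=
  (\sum_k y 0 k * dx k F x y) / (2 * F x y).

(* R^i_k = 2 [G^i]_{x^k} - y^j [G^i]_{x^j y^k} + 2 G^j [G^i]_{y^j y^k}
           - [G^i]_{y^j} [G^j]_{y^k}; row index i, column index k. *)
Definition riemann_curvature F x y : 'M[R]_n :=
  let G := spray_coef F in
  \matrix_(i, k)
    (2 * dx k (G i) x y
     - (\sum_j y 0 j * dy k (dx j (G i)) x y)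
     + 2 * (\sum_j G j x y * dy k (dy j (G i)) x y)
     - \sum_j dy j (G i) x y * dy k (G j) x y).

Definition inner F x y u v : R :=
  (u *m fundamental_tensor F x y *m v^T) 0 0.

(* Curvature of the flag with flagpole y and transverse edge u:
   g_y(R_y(u), u) / (g_y(y, y) g_y(u, u) - g_y(y, u)^2). *)
Definition flag_curvature F x y u : R :=
  inner F x y (u *m (riemann_curvature F x y)^T) u /
  (inner F x y y y * inner F x y u u - inner F x y y u ^+ 2).

Definition constant_flag_curvature Omega F (K : R) : Prop :=
  forall x y u, Omega x -> row_free (col_mx y u) -> flag_curvature F x y u = K.

(* c is continuous on [0, 1], and on each closed piece of some partition it is
   the restriction of a smooth curve defined on the whole line. *)
Definition piecewise_smooth (c : R -> vec) : Prop :=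
  exists2 s : seq R, itv_partition 0 1 s &
  forall i, (i < size s)%N -> exists2 g : R -> vec, smooth setT g &
    forall t, t \in `[nth 0 (0 :: s) i, nth 0 s i] -> c t = g t.

(* The derivative c' is only meaningful off the break points and the endpoints,
   a null set for the integral. *)
Definition curve_length F (c : R -> vec) : \bar R :=
  \int[lebesgue_measure]_(t in `[0, 1]) (F (c t) (derive1 c t))%:E.

Definition finsler_dist Omega F (x1 x2 : vec) : \bar R :=
  ereal_inf [set curve_length F c | c in
    [set c | [/\ piecewise_smooth c,
                 forall t, t \in `[0, 1] -> Omega (c t),
                 c 0 = x1 & c 1 = x2]]].

End Finsler.

(* Main.v *)
Require Import Defs.
From HB Require Import structures.
From mathcomp Require Import all_boot all_order all_algebra.
From mathcomp Require Import all_classical all_reals all_analysis.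
From mathcomp Require Import measurable_realfun ring lra.

Set Implicit Arguments.
Unset Strict Implicit.
Unset Printing Implicit Defensive.

Import Order.TTheory GRing.Theory Num.Theory.
Import numFieldNormedType.Exports.

Local Open Scope classical_set_scope.
Local Open Scope ring_scope.

(** Write [F] as a function on pairs and put [w := x2 - x1]. Comparing short
    geodesics with straight lines shows that the spray [G] is proportional to [y];
    this gives Hamel's equations [F_{x^k y^j} y^k = F_{x^j}], whose derivative says
    that [F_{x^i y^j}] is symmetric in [i] and [j]. So for the constant vector [w]
    the 1-form [F_{y^i}(x, w) dx^i] is closed, and on the convex domain it is [dh].
    By the fundamental inequality [F_{y^i}(x, w) v^i <= F(x, v)], with equality for
    [v = w], [h] calibrates the segment from [x1] to [x2]: the segment is minimizing
    and [d_F(x1, x2)] is the integral of [f(t) = F(x1 + t w, w)].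

    Along the segment [p(t) = P(x1 + t w, w)] satisfies [f' = 2 p f] and, by the
    curvature equation, [p' = p^2 - K f^2]. Hence [1/f] is a quadratic polynomial
    determined by [f(0)], [p(0)] and [K], and [f] has an explicit primitive. *)

(** * Calculus on open subsets of normed spaces *)

(** Flatness only says that the images of geodesics lie on lines, so it yields information on the
    spray at a given point and direction only once a geodesic with these initial data exists: hence
    the Picard-Lindelof theorem and the smoothness of [spray_coef]. The predicate [smooth] speaks of
    directional derivatives alone, so total differentiability, the chain rule and the symmetry of
    second derivatives have to be derived from it. The 1-form is evaluated at the constant vector
    [w] because the lines of direction [w] are geodesics that fill the domain. It is the Hilbert
    form along this field of extremals, and [h] lives on all of [Omega] without an exponential map
    or a discussion of conjugate points. The norm is not assumed smooth on the zero section.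
    Geodesics are therefore kept away from it, the convexity argument behind the fundamental
    inequality treats segments through 0 apart, and lengths need a separate proof of continuity at
    zero velocity. The curvature equation is read off one flag whose edge is orthogonal to its pole;
    this is where dimension at least 2 enters. *)

Section SmoothCalculus.
Context {R : realType} {V : normedModType R}.
Implicit Types (U : set V) (f g : V -> R) (k : nat) (v x : V).

Lemma derive_ext_on U f g v : open U -> (forall x, U x -> f x = g x) ->
  forall x, U x -> 'D_v f x = 'D_v g x.
Proof.
move=> oU fg x Ux; apply: near_eq_derive.
by apply: filterS (open_nbhs_nbhs (conj oU Ux)) => y; exact: fg.
Qed.

Lemma Ck_ext k U f g : open U -> (forall x, U x -> f x = g x) ->
  Ck k U f -> Ck k U g.
Proof.
elim: k f g => [|k IH] f g oU fg [cf Df].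
- split=> // x Ux; have fgx := open_nbhs_nbhs (conj oU Ux).
  rewrite /prop_for /continuous_at -(fg _ Ux).
  apply: cvg_trans (cf x Ux); apply: near_eq_cvg.
  by apply: filterS fgx => y; exact: fg.
- have nfg x : U x -> {near x, f =1 g}.
    move=> Ux; apply: filterS (open_nbhs_nbhs (conj oU Ux)) => y; exact: fg.
  split.
    move=> x Ux; rewrite /prop_for /continuous_at -(fg _ Ux).
    by apply: cvg_trans (cf x Ux); apply: near_eq_cvg; exact: nfg.
  move=> v; have [dfv Ckf] := Df v; split.
    by move=> x Ux; exact: near_eq_derivable (nfg x Ux) (dfv x Ux).
  by apply: IH Ckf => //; exact: derive_ext_on.
Qed.

Lemma CkW k U f : Ck k.+1 U f -> Ck k U f.
Proof.
elim: k f => [|k IH] f [cf Df]; split=> // v.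
by have [? ?] := Df v; split=> //; exact: IH.
Qed.

Lemma CkD k U f g : open U -> Ck k U f -> Ck k U g ->
  Ck k U (fun x => f x + g x).
Proof.
move=> oU; elim: k f g => [|k IH] f g [cf Df] [cg Dg].
  by split=> // x Ux; apply: continuousD; [exact: cf|exact: cg].
split=> [x Ux|v]; first by apply: continuousD; [exact: cf|exact: cg].
have [df Ckf] := Df v; have [dg Ckg] := Dg v; split.
  by move=> x Ux; apply: derivableD; [exact: df|exact: dg].
apply: Ck_ext (IH _ _ Ckf Ckg) => // x Ux.
by rewrite [RHS](deriveD (df x Ux) (dg x Ux)).
Qed.

Lemma CkM k U f g : open U -> Ck k U f -> Ck k U g ->
  Ck k U (fun x => f x * g x).
Proof.
move=> oU; elim: k f g => [|k IH] f g Hf Hg; have [cf Df] := Hf; have [cg Dg] := Hg.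
  by split=> // x Ux; apply: continuousM; [exact: cf|exact: cg].
split=> [x Ux|v]; first by apply: continuousM; [exact: cf|exact: cg].
have [df Ckf] := Df v; have [dg Ckg] := Dg v; split.
  by move=> x Ux; apply: derivableM; [exact: df|exact: dg].
apply: Ck_ext (CkD oU (IH _ _ (CkW Hf) Ckg) (IH _ _ (CkW Hg) Ckf)) => // x Ux.
by rewrite [RHS](deriveM (df x Ux) (dg x Ux)).
Qed.

Lemma Ck_cst (W : normedModType R) k U (a : W) : Ck k U (fun=> a).
Proof.
elim: k a => [|k IH] a; first by split=> // x _; exact: cst_continuous.
split=> [x _|v]; first exact: cst_continuous.
split=> [x _|]; first exact: derivable_cst.
have -> : 'D_v (fun=> a) = (fun=> 0) :> (V -> W); last exact: IH.
by apply/funext => x; rewrite derive_cst.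
Qed.

Lemma Ck_lin k U f : continuous f ->
  (forall x v (h : R), f (h *: v + x) = h * f v + f x) -> Ck k U f.
Proof.
move=> cf lf.
have L x v : (fun h : R => h^-1 *: (f (h *: v + x) - f x)) @ 0^' --> f v.
  apply: cvg_near_cst; near=> h.
  rewrite lf addrK /GRing.scale/= mulKf//.
  by near: h; exact: nbhs_dnbhs_neq.
case: k => [|k]; first by split=> // x _; exact: cf.
split=> [x _|v]; first exact: cf.
split=> [x _|]; first by apply/cvg_ex; exists (f v); exact: L.
have -> : 'D_v f = (fun=> f v) :> (V -> R); last exact: Ck_cst.
by apply/funext => x; apply/cvg_lim => //; exact: L.
Unshelve. all: by end_near. Qed.

Lemma CkN k U f : open U -> Ck k U f -> Ck k U (fun x => - f x).
Proof.
move=> oU Hf; apply: Ck_ext (CkM oU (Ck_cst k U (-1 : R)) Hf) => // x _.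
by rewrite mulN1r.
Qed.

Lemma CkV k U f : open U -> (forall x, U x -> f x != 0) -> Ck k U f ->
  Ck k U (fun x => (f x)^-1).
Proof.
move=> oU f0; elim: k => [|k IH] Hf; have [cf Df] := Hf.
  by split=> // x Ux; apply: continuousV; [exact: f0|exact: cf].
split=> [x Ux|v]; first by apply: continuousV; [exact: f0|exact: cf].
have [df Ckf] := Df v; split.
  by move=> x Ux; apply: derivableV; [exact: f0|exact: df].
have HV := IH (CkW Hf).
apply: Ck_ext (CkN oU (CkM oU (CkM oU HV HV) Ckf)) => // x Ux.
rewrite [RHS](deriveV (f0 x Ux) (df x Ux)) /GRing.scale/= expr2 invfM.
by rewrite mulNr.
Qed.

Lemma Ck_sum k U (I : Type) (s : seq I) (P : pred I) (F : I -> V -> R) : open U ->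
  (forall i, P i -> Ck k U (F i)) -> Ck k U (fun x => \sum_(i <- s | P i) F i x).
Proof.
move=> oU HF; elim: s => [|i s IH].
  by apply: Ck_ext (Ck_cst k U (0 : R)) => // x _; rewrite big_nil.
case Pi: (P i).
  by apply: Ck_ext (CkD oU (HF i Pi) IH) => // x _; rewrite big_cons Pi.
by apply: Ck_ext IH => // x _; rewrite big_cons Pi.
Qed.

Lemma Ck_prod k U (I : Type) (s : seq I) (P : pred I) (F : I -> V -> R) : open U ->
  (forall i, P i -> Ck k U (F i)) -> Ck k U (fun x => \prod_(i <- s | P i) F i x).
Proof.
move=> oU HF; elim: s => [|i s IH].
  by apply: Ck_ext (Ck_cst k U (1 : R)) => // x _; rewrite big_nil.
case Pi: (P i).
  by apply: Ck_ext (CkM oU (HF i Pi) IH) => // x _; rewrite big_cons Pi.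
by apply: Ck_ext IH => // x _; rewrite big_cons Pi.
Qed.

Lemma Ck_det k U n (A : V -> 'M[R]_n) : open U ->
  (forall i j, Ck k U (fun x => A x i j)) -> Ck k U (fun x => \det (A x)).
Proof.
move=> oU HA; apply: Ck_sum => // s _; apply: CkM => //; first exact: Ck_cst.
by apply: Ck_prod.
Qed.

(** Cramer's rule: the entries are cofactors divided by the determinant, so products, sums and one
    inverse suffice. It is used for the inverse metric in the spray. *)
Lemma Ck_invmx k U n (A : V -> 'M[R]_n) : open U ->
  (forall x, U x -> A x \in unitmx) ->
  (forall i j, Ck k U (fun x => A x i j)) ->
  forall i j, Ck k U (fun x => invmx (A x) i j).
Proof.
move=> oU uA HA i j.
apply: (@Ck_ext _ _ (fun x => (\det (A x))^-1 * \adj (A x) i j)) => //.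
  by move=> x Ux; rewrite /invmx uA // [RHS]mxE.
apply: CkM => //.
  apply: CkV => //; last exact: Ck_det.
  by move=> x Ux; rewrite -unitfE -unitmxE; exact: uA.
apply: (@Ck_ext _ _ (fun x => (-1) ^+ (j + i) * \det (row' j (col' i (A x))))) => //.
  by move=> x Ux; rewrite mxE.
apply: CkM => //; first exact: Ck_cst.
apply: Ck_det => // i0 j0; apply: Ck_ext (HA (lift j i0) (lift i j0)) => // x _.
by rewrite !mxE.
Qed.

Lemma smooth_derive U f v : smooth U f -> smooth U ('D_v f).
Proof. by move=> sf k; have [_ /(_ v)[]] := sf k.+1. Qed.

Lemma smooth_derivable U f v x : smooth U f -> U x -> derivable f x v.
Proof. by move=> sf Ux; have [_ /(_ v)[+ _]] := sf 1; exact. Qed.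

Lemma smooth_continuous U f x : smooth U f -> U x -> {for x, continuous f}.
Proof. by move=> sf Ux; have [+ _] := sf 0; exact. Qed.

End SmoothCalculus.

(** * Continuous directional derivatives imply differentiability *)

Section Differentiability.
Context {R : realType} {V : normedModType R}.
Implicit Types (U : set V) (f g : V -> R) (v x : V).

Lemma is_derive_line (W : normedModType R) (F : V -> W) x v (t : R) :
  derivable F (x + t *: v) v ->
  is_derive t 1 (fun t : R => F (x + t *: v)) ('D_v F (x + t *: v)).
Proof.
have E (h : R) : x + (h *: 1 + t) *: v = h *: v + (x + t *: v).
  by rewrite scalerDl [h *: 1]mulr1 addrCA.
move=> dF; apply: DeriveDef.
  by move: dF; rewrite /derivable/=; under [in X in _ -> X]eq_fun do rewrite E.
by rewrite /derive/=; under [in LHS]eq_fun do rewrite E.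
Qed.

(** Scaling the parameter to the unit interval covers [a] of either sign, and [a = 0], without a
    case split. *)
Lemma MVT_line f x v (a : R) :
  (forall t : R, 0 <= t <= 1 -> derivable f (x + (t * a) *: v) v) ->
  exists2 c : R, 0 <= c <= 1 &
    f (x + a *: v) - f x = a * 'D_v f (x + (c * a) *: v).
Proof.
move=> df; pose g (t : R) := f (x + (t * a) *: v).
have dg (t : R) : 0 <= t <= 1 -> is_derive t 1 g (a * 'D_v f (x + (t * a) *: v)).
  move=> t01.
  have H1 := is_derive_line (df t t01).
  have H2 : is_derive t 1 (fun t : R => t * a) a.
    have H := @is_deriveM _ _ id (fun=> a) t 1 1 0 _ _.
    by apply: is_derive_eq; rewrite scaler0 add0r [_ *: 1]mulr1.
  have H3 := @is_derive1_comp _ (fun t : R => f (x + t *: v)) (fun t : R => t * a) t _ _ H1 H2.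
  by apply: is_derive_eq; rewrite mulrC.
have cg : {within `[0, 1], continuous g}.
  apply: derivable_within_continuous => t; rewrite in_itv/= => t01.
  by have [] := dg t t01.
have [c] := @MVT_segment _ g (fun t => a * 'D_v f (x + (t * a) *: v)) 0 1 ler01
  (fun t t01 => dg t (subset_itv_oo_cc t01)) cg.
rewrite in_itv/= => c01; rewrite subr0 mulr1 /g mul1r mul0r scale0r addr0 => E.
by exists c.
Qed.

Lemma differentiable_of_lin f x (L : V -> R) :
  (forall a u v, L (a *: u + v) = a * L u + L v) -> continuous L ->
  (forall e : R, 0 < e -> \forall h \near (0 : V),
     `|f (h + x) - f x - L h| <= e * `|h|) ->
  differentiable f x.
Proof.
move=> linL cL H.
pose LM := GRing.isLinear.Build R V R _ L (linL : linear_for _ L).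
pose LL : {linear V -> R} := HB.pack L LM.
have E : f \o shift x = cst (f x) + LL +o_ (0 : V) id.
  apply/eqaddoP => e e0; have := H e e0; apply: filterS => h.
  by rewrite /= !fctE opprD addrA.
by apply/diff_locallyP; rewrite (diff_unique (df := LL) cL E).
Qed.

(** Abstract coordinates: [e] spans [V] and [co] gives the components. Row vectors and pairs of row
    vectors are the two instances. *)
Variables (I : Type) (s : seq I) (e : I -> V) (co : I -> V -> R).
Hypothesis co_lin : forall i a u v, co i (a *: u + v) = a * co i u + co i v.
Hypothesis co_bnd : forall i v, `|co i v| <= `|v|.
Hypothesis co_dec : forall v, v = \sum_(i <- s) co i v *: e i.

Lemma co_cont i : continuous (co i).
Proof.
move=> x; apply/cvgrPdist_le => r r0; near=> y.
have -> : co i x - co i y = co i (x - y).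
  by rewrite (_ : x - y = -1 *: y + x) ?co_lin ?scaleN1r 1?addrC//; ring.
apply: le_trans (co_bnd i _) _; near: y.
by apply: cvgr_dist_le.
Unshelve. all: by end_near. Qed.

Lemma co0 i : co i 0 = 0.
Proof.
by apply/eqP; rewrite -normr_le0 -(normr0 V) co_bnd.
Qed.

(** Keeps every corner of the coordinate path from [x] to [x + h], together with its next edge, in a
    prescribed ball around [x]. *)
Lemma partial_sum_cvg0 (s' : seq I) (i : I) :
  (fun h => `|\sum_(i <- s') co i h *: e i| + `|co i h *: e i|) @ (0 : V) --> (0 : R).
Proof.
have Z j : (fun h => co j h *: e j) @ (0 : V) --> (0 : V).
  rewrite -{2}(scale0r (e j)) -(co0 j); apply: cvgZr_tmp; exact: co_cont.
have N (u : V -> V) : u @ (0 : V) --> (0 : V) ->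
    (fun h => `|u h|) @ (0 : V) --> (0 : R).
  by move=> /cvg_norm; rewrite normr0; exact.
rewrite -[X in _ --> X]addr0; apply: cvgD; apply: N => //.
elim: s' => [|j s' IH].
  rewrite (_ : (fun _ => _) = (fun=> 0)); first exact: cvg_cst.
  by apply/funext => h; rewrite big_nil.
rewrite (_ : (fun h => \sum_(i0 <- _) _) =
  (fun h => co j h *: e j + \sum_(i0 <- s') co i0 h *: e i0)).
  by rewrite -[X in _ --> X]addr0; apply: cvgD.
by apply/funext => h; rewrite big_cons.
Qed.

(** Walk from [x] to [x + h] one coordinate at a time. On each edge the mean value theorem gives a
    partial derivative at a point near [x], which continuity compares with its value at [x]. *)
Lemma C1_differentiable U f x : open U ->
  (forall v y, U y -> derivable f y v) ->
  (forall v y, U y -> {for y, continuous ('D_v f)}) ->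
  U x -> differentiable f x.
Proof.
move=> oU D C Ux.
pose L h := \sum_(i <- s) co i h * 'D_(e i) f x.
apply: (@differentiable_of_lin _ _ L).
- move=> a u v; rewrite /L mulr_sumr -big_split/=; apply: eq_bigr => i _.
  by rewrite co_lin; ring.
- rewrite /L; apply: continuous_big => [|i _ h]; first exact: add_continuous; apply: cvgMr_tmp; exact: co_cont.
(* Induction on the coordinates already walked, for every error [r]: half of [r] goes to the new
   edge and half to the induction hypothesis. *)
have K (s' : seq I) (r : R) : 0 < r -> \forall h \near (0 : V),
   `|f (x + \sum_(i <- s') co i h *: e i) - f x
     - \sum_(i <- s') co i h * 'D_(e i) f x| <= r * `|h|.
  elim: s' r => [|i s' IH] r r0.
    by near=> h; rewrite !big_nil addr0 !subrr normr0 mulr_ge0// ltW.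
  have r20 : 0 < r / 2 by rewrite divr_gt0.
  have N : \forall y \near x, U y /\ `|'D_(e i) f x - 'D_(e i) f y| <= r / 2.
    apply: filterI; first exact: open_nbhs_nbhs.
    by have /cvgrPdist_le := C (e i) x Ux; apply.
  have /nbhs_ballP[d /= d0 bd] := N.
  have /cvgrPdist_lt/(_ d d0) P0 := partial_sum_cvg0 s' i.
  near=> h; rewrite !big_cons.
  have P0h : `|0 - (`|\sum_(j <- s') co j h *: e j| + `|co i h *: e i|)| < d.
    by near: h.
  have IHh : `|f (x + \sum_(j <- s') co j h *: e j) - f x
      - \sum_(j <- s') co j h * 'D_(e j) f x| <= r / 2 * `|h|.
    by near: h; exact: IH.
  move: P0h IHh; set w := \sum_(j <- s') co j h *: e j => P0h IHh.
  have wd : `|w| + `|co i h *: e i| < d.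
    by move: P0h; rewrite sub0r normrN ger0_norm// addr_ge0.
  have B (t : R) : 0 <= t <= 1 -> ball x d (x + w + (t * co i h) *: e i).
    move=> /andP[t0 t1]; rewrite -ball_normE/= -addrA opprD addNKr normrN.
    apply: le_lt_trans (ler_normD _ _) (le_lt_trans _ wd).
    rewrite lerD2l -scalerA normrZ ger0_norm//.
    by rewrite ler_piMl.
  have [t01|c c01 E] := @MVT_line f (x + w) (e i) (co i h).
    by move=> B01; apply: D; have [] := bd _ (B _ B01).
  have -> : x + (co i h *: e i + w) = x + w + co i h *: e i by rewrite addrAC -addrA.
  rewrite (_ : _ - f x - _ = (f (x + w + co i h *: e i) - f (x + w)
     - co i h * 'D_(e i) f x) + (f (x + w) - f x - \sum_(j <- s') co j h * 'D_(e j) f x)); last by ring.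
  apply: le_trans (ler_normD _ _) _.
  rewrite [r in leRHS]splitr mulrDl; apply: lerD; last by [].
  rewrite E -mulrBr normrM [leLHS]mulrC; apply: ler_pM => //.
  by rewrite distrC; have [] := bd _ (B _ c01).
move=> r r0; apply: filterS (K s r r0) => h.
by rewrite -co_dec (addrC x).
Unshelve. all: by end_near. Qed.

End Differentiability.

(** * Symmetry of second derivatives *)

Section Schwarz.
Context {R : realType} {V : normedModType R}.
Implicit Types (U : set V) (f : V -> R) (u v x w : V).

Lemma is_derive_translate f x v w :
  derivable f (x + w) v -> is_derive x v (fun y => f (y + w)) ('D_v f (x + w)).
Proof.
have E (h : R) : h *: v + x + w = h *: v + (x + w) by rewrite addrA.
move=> df; apply: DeriveDef.
  by move: df; rewrite /derivable/=; under [in X in _ -> X]eq_fun do rewrite E.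
by rewrite /derive/=; under [in LHS]eq_fun do rewrite E.
Qed.

(** The mean value theorem is applied twice: to [y |-> f (y + s *: v) - f y] in direction [u], then
    to ['D_u f] in direction [v]. *)
Lemma second_difference f x u v (s : R) :
  (forall a b : R, 0 <= a <= 1 -> 0 <= b <= 1 ->
     derivable f (x + (a * s) *: u + (b * s) *: v) u /\
     derivable ('D_u f) (x + (a * s) *: u + (b * s) *: v) v) ->
  exists a b : R, [/\ 0 <= a <= 1, 0 <= b <= 1 &
    f (x + s *: u + s *: v) - f (x + s *: u) - f (x + s *: v) + f x =
    s * (s * 'D_v ('D_u f) (x + (a * s) *: u + (b * s) *: v))].
Proof.
move=> H.
have i0 : (0 : R) <= (0 : R) <= (1 : R) by rewrite lexx ler01.
have i1 : (0 : R) <= (1 : R) <= (1 : R) by rewrite ler01 lexx.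
have D1 (t : R) : 0 <= t <= 1 -> derivable f (x + (t * s) *: u + s *: v) u.
  by move=> t01; have [+ _] := H t 1 t01 i1; rewrite mul1r.
have D0 (t : R) : 0 <= t <= 1 -> derivable f (x + (t * s) *: u) u.
  by move=> t01; have [+ _] := H t 0 t01 i0; rewrite mul0r scale0r addr0.
pose g y := f (y + s *: v) - f y.
have dg (t : R) : 0 <= t <= 1 -> is_derive (x + (t * s) *: u) u g
   ('D_u f (x + (t * s) *: u + s *: v) - 'D_u f (x + (t * s) *: u)).
  move=> t01; apply: is_deriveB; first exact: is_derive_translate (D1 t t01).
  exact: derivableP (D0 t t01).
have [|a a01 Ea] := @MVT_line _ _ g x u s.
  by move=> t t01; have [] := dg t t01.
have [|b b01 Eb] := @MVT_line _ _ ('D_u f) (x + (a * s) *: u) v s.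
  by move=> t t01; have [_ +] := H a t a01 t01.
exists a, b; split => //; rewrite -Eb.
have [_ <-] := dg a a01.
by rewrite -Ea /g; ring.
Qed.

(** The second difference is symmetric in [u] and [v], so the two mixed derivatives agree at
    suitable points of an arbitrarily small parallelogram at [x]; continuity carries this to [x]. *)
Lemma Schwarz U f x u v : open U -> smooth U f -> U x ->
  'D_u ('D_v f) x = 'D_v ('D_u f) x.
Proof.
move=> oU sf Ux.
have sD w w' : smooth U ('D_w ('D_w' f)) by do 2!apply: smooth_derive.
apply/eqP; rewrite -subr_eq0 -normr_le0; apply/ler_addgt0Pl => e e0.
rewrite addr0.
have e20 : 0 < e / 2 by rewrite divr_gt0.
have N w w' : \forall y \near x, `|'D_w ('D_w' f) x - 'D_w ('D_w' f) y| <= e / 2.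
  by have /cvgrPdist_le := smooth_continuous (sD w w') Ux; apply.
have NN : \forall y \near x, U y /\
    (`|'D_u ('D_v f) x - 'D_u ('D_v f) y| <= e / 2 /\
     `|'D_v ('D_u f) x - 'D_v ('D_u f) y| <= e / 2).
  by apply: filterI; [exact: open_nbhs_nbhs|apply: filterI; exact: N].
have /nbhs_ballP[d /= d0 bd] := NN.
(* Small enough for the parallelogram to fit in the ball of radius [d]; the summand 1 keeps the
   divisor positive when both vectors vanish. *)
pose s := d / 2 / (`|u| + `|v| + 1).
have uv0 : 0 < `|u| + `|v| + 1 by rewrite ltr_wpDl// addr_ge0.
have s0 : 0 < s by rewrite /s !divr_gt0.
have B (a b : R) : 0 <= a <= 1 -> 0 <= b <= 1 ->
    ball x d (x + (a * s) *: u + (b * s) *: v).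
  move=> /andP[a0 a1] /andP[b0 b1].
  rewrite -ball_normE/= -addrA opprD addNKr normrN.
  apply: le_lt_trans (ler_normD _ _) _.
  have Nr (c : R) w : 0 <= c -> `|(c * s) *: w| = c * s * `|w|.
    by move=> c0; rewrite normrZ ger0_norm// mulr_ge0// ltW.
  rewrite !Nr//.
  have sd : s * (`|u| + `|v| + 1) = d / 2 by rewrite divfK// gt_eqF.
  apply: (@le_lt_trans _ _ (s * (`|u| + `|v| + 1))).
    have : a * s * `|u| <= s * `|u| by rewrite -mulrA ler_piMl// mulr_ge0// ltW.
    have : b * s * `|v| <= s * `|v| by rewrite -mulrA ler_piMl// mulr_ge0// ltW.
    by move: s0; lra.
  by rewrite sd; move: d0; lra.
have [a1 b1 a01 b01|a [b [a01 b01 E1]]] := @second_difference f x u v s.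
  have [Uy _] := bd _ (B _ _ a01 b01).
  split; first exact: smooth_derivable sf Uy.
  exact: smooth_derivable (smooth_derive u sf) Uy.
have B' (a' b' : R) : 0 <= a' <= 1 -> 0 <= b' <= 1 ->
    ball x d (x + (a' * s) *: v + (b' * s) *: u).
  by move=> a01' b01'; rewrite addrAC; exact: B.
have [a1 b1 a01' b01'|a' [b' [a01' b01' E2]]] := @second_difference f x v u s.
  have [Uy _] := bd _ (B' _ _ a01' b01').
  split; first exact: smooth_derivable sf Uy.
  exact: smooth_derivable (smooth_derive v sf) Uy.
have EE : 'D_v ('D_u f) (x + (a * s) *: u + (b * s) *: v) =
          'D_u ('D_v f) (x + (a' * s) *: v + (b' * s) *: u).
  apply: (mulfI (lt0r_neq0 s0)); apply: (mulfI (lt0r_neq0 s0)).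
  apply: etrans (esym E1) (etrans _ E2).
  by rewrite [x + s *: v + _]addrAC; congr (_ + _); exact: addrAC.
have [_ [_ H1]] := bd _ (B _ _ a01 b01).
have [_ [H2 _]] := bd _ (B' _ _ a01' b01').
rewrite (splitr e); move: H1; rewrite EE => H1.
set p := 'D_u ('D_v f) (x + _ + _) in H1 H2.
move: ('D_u ('D_v f) x) ('D_v ('D_u f) x) p H1 H2 => a2 b2 p H1 H2.
rewrite (_ : a2 - b2 = (a2 - p) - (b2 - p)); last by ring.
by apply: le_trans (ler_normB _ _) _; exact: lerD.
Qed.

End Schwarz.

Section Coordinates.
Context {R : realType} {n : nat}.
Local Notation vec := 'rV[R]_n.

Lemma coord_le_norm (v : vec) i : `|v 0 i| <= `|v|.
Proof. by rewrite [leRHS]/Num.norm/= mx_normrE; exact: (le_bigmax _ _ (0, i)). Qed.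

Lemma rV_C1_differentiable (U : set vec) (f : vec -> R) x : open U ->
  (forall v y, U y -> derivable f y v) ->
  (forall v y, U y -> {for y, continuous ('D_v f)}) ->
  U x -> differentiable f x.
Proof.
apply: (@C1_differentiable _ _ 'I_n (index_enum 'I_n) (fun i => delta_mx 0 i)
  (fun i v => v 0 i)).
- by move=> i a u v; rewrite !mxE.
- by move=> i v; exact: coord_le_norm.
- by move=> v; exact: row_sum_delta.
Qed.

Lemma prod_C1_differentiable (U : set (vec * vec)) (f : vec * vec -> R) x : open U ->
  (forall v y, U y -> derivable f y v) ->
  (forall v y, U y -> {for y, continuous ('D_v f)}) ->
  U x -> differentiable f x.
Proof.
apply: (@C1_differentiable _ _ ('I_n + 'I_n)%type (index_enum ('I_n + 'I_n)%type)
  (fun i => match i with inl i => (delta_mx 0 i, 0) | inr i => (0, delta_mx 0 i) end)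
  (fun i v => match i with inl i => v.1 0 i | inr i => v.2 0 i end)).
- by move=> [] i a u v /=; rewrite !mxE.
- move=> [] i v; apply: le_trans (coord_le_norm _ i) _.
    by rewrite prod_normE le_max lexx.
  by rewrite prod_normE le_max lexx orbT.
- have fst_sum (I : Type) (s : seq I) (F : I -> vec * vec) :
    (\sum_(k <- s) F k).1 = \sum_(k <- s) (F k).1 by rewrite raddf_sum.
  have snd_sum (I : Type) (s : seq I) (F : I -> vec * vec) :
    (\sum_(k <- s) F k).2 = \sum_(k <- s) (F k).2 by rewrite raddf_sum.
  move=> [a b]; rewrite [RHS]surjective_pairing fst_sum snd_sum !big_sumType/=.
  rewrite -!row_sum_delta; congr pair.
    by rewrite [X in _ + X]big1 ?addr0// => i _; rewrite scaler0.
  by rewrite [X in X + _]big1 ?add0r// => i _; rewrite scaler0.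
Qed.

End Coordinates.

Section ChainRule.
Context {R : realType} {V : normedModType R}.

Lemma is_derive_curve (f : V -> R) (g : R -> V) (t : R) (v : V) :
  differentiable f (g t) -> is_derive t 1 g v ->
  is_derive t 1 (fun s => f (g s)) ('D_v f (g t)).
Proof.
move=> df [dg <-].
have dg' : differentiable g t by apply/derivable1_diffP.
have dfg : differentiable (f \o g) t by exact: differentiable_comp.
apply: DeriveDef; first exact: diff_derivable.
by rewrite !deriveE// diff_comp.
Qed.

Lemma derive_linear (f : V -> R) x (a : R) u v : differentiable f x ->
  'D_(a *: u + v) f x = a * 'D_u f x + 'D_v f x.
Proof. by move=> df; rewrite !deriveE// linearP. Qed.

Lemma derive_lin_sum (f : V -> R) x (I : Type) (s : seq I) (a : I -> R) (e : I -> V) :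
  differentiable f x ->
  'D_(\sum_(i <- s) a i *: e i) f x = \sum_(i <- s) a i * 'D_(e i) f x.
Proof.
move=> df; rewrite deriveE// linear_sum; apply: eq_bigr => i _.
by rewrite linearZ deriveE.
Qed.

End ChainRule.

(** * The Picard-Lindelof theorem *)

Section Picard.
Context {R : realType}.

Lemma antiderivative (f : R -> R) : continuous f ->
  exists2 G : R -> R, G 0 = 0 & forall x : R, `|x| < 1 -> is_derive x 1 G (f x).
Proof.
move=> cf.
(* Integrating from -1 makes 0 an interior point of the domain of the primitive; the normalization
   at 0 is obtained by subtraction. *)
pose G x := (\int[lebesgue_measure]_(t in `[-1, x]) f t)%R.
exists (fun x => G x - G 0); first exact: subrr.
move=> x; rewrite ltr_norml => /andP[x1 x2].
have If : lebesgue_measure.-integrable `[(-1 : R), 1] (EFin \o f).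
  apply: continuous_compact_integrable; first exact: segment_compact.
  exact: continuous_subspaceT.
have [dG GE] := continuous_FTC1_closed x2 If x1 (cf x).
have D : is_derive x 1 G (f x) by apply: DeriveDef; [exact: dG|rewrite -derive1E; exact: GE].
have := is_deriveB D (is_derive_cst (G 0) x 1).
by rewrite subr0.
Qed.

Context {m : nat}.
Local Notation vec := 'rV[R]_m.

Lemma is_derive_row (g : 'I_m -> R -> R) (dg : 'I_m -> R) (t : R) :
  (forall i, is_derive t 1 (g i) (dg i)) ->
  is_derive t 1 (fun s => \row_i g i s) (\row_i dg i).
Proof.
move=> H.
have E i j : (fun s => (\row_k g k s) i j) = g j.
  by apply/funext => s; rewrite mxE.
have D : derivable (fun s => \row_i g i s : vec) t 1.
  by apply/derivable_mxP => i j; rewrite E; have [] := H j.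
apply: DeriveDef => //; rewrite derive_mx//; apply/matrixP => i j.
by rewrite !mxE E; have [_ ->] := H j.
Qed.

Lemma row_norm_le (v : vec) (a : R) : 0 <= a -> (forall i, `|v 0 i| <= a) -> `|v| <= a.
Proof.
move=> a0 H; rewrite /Num.norm/= mx_normrE; apply/bigmax_leP; split=> // -[i j] _ /=.
by rewrite (ord1 i).
Qed.

Variables (V : vec -> vec) (z0 : vec) (r L : R).
Hypotheses (r0 : 0 < r) (L0 : 0 <= L).
Hypothesis V_lip : forall a b, `|a - z0| < r -> `|b - z0| < r ->
  `|V a - V b| <= L * `|a - b|.

(** [M] bounds the field near [z0]. The time [d] is below 1, where [antiderivative] applies, has
    [d * M <= r / 2], so that iterates stay in the half ball, and [d * L <= 1/2], so that the
    iteration contracts. The summands 1 avoid division by zero. *)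
Let M := `|V z0| + L * r + 1.
Let d := Num.min (2^-1) (Num.min (r / 2 / M) (2^-1 / (L + 1))).
(* The Picard iteration runs on functions on the whole line that only depend on the
   clamped time, so that no function space on a segment is needed. *)
Let clamp (t : R) := Num.max (- d) (Num.min t d).

Let M0 : 0 < M.
Proof. by rewrite ltr_wpDl// addr_ge0// mulr_ge0// ltW. Qed.

Let d0 : 0 < d.
Proof.
have L1 : 0 < L + 1 by rewrite ltr_wpDl.
have h0 : (0 : R) < 2^-1 by rewrite invr_gt0.
by rewrite /d !lt_min h0 !divr_gt0.
Qed.

Let d1 : d < 1.
Proof.
apply: (@le_lt_trans _ _ (2^-1)).
  by rewrite /d ge_min lexx.
by rewrite invf_lt1// ltr1n.
Qed.

Let dM : d * M <= r / 2.
Proof. by rewrite -ler_pdivlMr// /d !ge_min lexx !orbT. Qed.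

Let dL : d * L <= 2^-1.
Proof.
have L10 : 0 < L + 1 by rewrite ltr_wpDl.
have : d * (L + 1) <= 2^-1 by rewrite -ler_pdivlMr// /d !ge_min lexx !orbT.
by have := ltW d0; lra.
Qed.

Let clamp_le t : `|clamp t| <= d.
Proof.
rewrite ler_norml /clamp le_max lexx/= ge_max ge_min lexx orbT andbT.
by have := d0; lra.
Qed.

Let clamp_id t : `|t| < d -> clamp t = t.
Proof.
rewrite ltr_norml => /andP[/ltW t1 /ltW t2].
by rewrite /clamp (min_idPl t2) (max_idPr t1).
Qed.

Let clamp_cont : continuous clamp.
Proof.
move=> t.
apply: (@continuous_max R R (fun=> - d) (fun t => Num.min t d) t).
  exact: cst_continuous.
apply: (@continuous_min R R (fun t => t) (fun=> d) t); last exact: cst_continuous.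
exact: cvg_id.
Qed.

(** The closed ball of radius [r / 2] is stable under limits and lies inside the open ball where the
    Lipschitz bound holds. *)
Let adm (u : R -> vec) := continuous u /\ forall t, `|u t - z0| <= r / 2.

(** The Picard operator as a relation, because primitives are only known to exist; a function is
    chosen in [fixed_point]. *)
Let step (u v : R -> vec) := exists2 G : 'I_m -> R -> R,
  forall i, G i 0 = 0 /\ forall x : R, `|x| < 1 -> is_derive x 1 (G i) (V (u x) 0 i) &
  v = fun t => \row_i (z0 0 i + G i (clamp t)).

Let half (a : vec) : `|a - z0| <= r / 2 -> `|a - z0| < r.
Proof. by move=> H; apply: le_lt_trans H _; move: r0; lra. Qed.

Let V_bnd (a : vec) : `|a - z0| <= r / 2 -> `|V a| <= M.
Proof.
move=> /half H; have z00 : `|z0 - z0| < r by rewrite subrr normr0.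
have := V_lip H z00; have := ler_normD (V z0) (V a - V z0).
rewrite addrC subrK => H1 H2.
have : L * `|a - z0| <= L * r by rewrite ler_wpM2l// ltW.
by rewrite /M; move: H1 H2; lra.
Qed.

Let primitive_bound (G g : R -> R) (a : R) x : G 0 = 0 ->
  (forall x : R, `|x| < 1 -> is_derive x 1 G (g x)) -> (forall x, `|g x| <= a) ->
  `|x| < 1 -> `|G x| <= `|x| * a.
Proof.
move=> G0 dG ga x1.
have Nt (t : R) : 0 <= t <= 1 -> `|t * x| < 1.
  move=> /andP[t0 t1]; rewrite normrM (ger0_norm t0).
  by apply: le_lt_trans x1; rewrite ler_piMl.
have E (y : R) : (0 : R) + y *: (1 : R) = y by rewrite add0r [_ *: _]mulr1.
have [|c c01] := @MVT_line _ _ G 0 1 x.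
  by move=> t /Nt t01; rewrite E; have [] := dG _ t01.
rewrite !E G0 subr0 => ->.
have [_ ->] := dG _ (Nt c c01).
by rewrite normrM ler_wpM2l.
Qed.

Let step_adm u v : adm u -> step u v -> adm v.
Proof.
move=> [cu bu] [G GP ->]; split.
  move=> t; pose w (s : R) : vec := \row_i (z0 0 i + G i s).
  apply: (@continuous_comp _ _ _ clamp w); first exact: clamp_cont.
  apply/differentiable_continuous/derivable1_diffP.
  have ct1 : `|clamp t| < 1 by exact: le_lt_trans (clamp_le t) d1.
  have [] // := @is_derive_row (fun i s => z0 0 i + G i s)
    (fun i => 0 + V (u (clamp t)) 0 i) (clamp t) _.
  by move=> i; apply: is_deriveD; have [_ +] := GP i; apply.
move=> t; apply: row_norm_le => [|i]; first by rewrite divr_ge0// ltW.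
rewrite !mxE addrAC subrr add0r; have [G0 dG] := GP i.
apply: le_trans (primitive_bound (a := M) G0 dG _ _) _.
- by move=> x; apply: le_trans (coord_le_norm _ _) _; exact: V_bnd.
- exact: le_lt_trans (clamp_le t) d1.
- by apply: le_trans dM; rewrite ler_wpM2r// ltW.
Qed.

Let step_ex u : adm u -> exists v, step u v.
Proof.
move=> [cu bu].
have cV i : continuous (fun x => V (u x) 0 i).
  move=> x; apply/cvgrPdist_le => e e0.
  have e1 : 0 < e / (L + 1) by rewrite divr_gt0// ltr_wpDl.
  near=> y.
  have -> : V (u x) 0 i - V (u y) 0 i = (V (u x) - V (u y)) 0 i by rewrite !mxE.
  apply: le_trans (coord_le_norm _ _) _.
  apply: le_trans (V_lip (half (bu x)) (half (bu y))) _.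
  have : `|u x - u y| <= e / (L + 1).
    by near: y; have /cvgrPdist_le := cu x; apply.
  rewrite ler_pdivlMr ?ltr_wpDl// => H.
  by have := normr_ge0 (u x - u y); move: H; lra.
have /choice[G GP] : forall i, exists G : R -> R, G 0 = 0 /\
    forall x : R, `|x| < 1 -> is_derive x 1 G (V (u x) 0 i).
  by move=> i; have [G G0 dG] := antiderivative (cV i); exists G.
by exists (fun t => \row_i (z0 0 i + G i (clamp t))), G.
Unshelve. all: by end_near. Qed.

Let step_contract u u' v v' (C : R) : adm u -> adm u' -> step u v -> step u' v' ->
  (forall t, `|u t - u' t| <= C) -> forall t, `|v t - v' t| <= C / 2.
Proof.
move=> [_ bu] [_ bu'] [G GP ->] [G' GP' ->] HC t.
have C0 : 0 <= C by apply: le_trans (HC 0).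
apply: row_norm_le => [|i]; first by rewrite divr_ge0.
rewrite !mxE opprD addrACA subrr add0r.
have [G0 dG] := GP i; have [G0' dG'] := GP' i.
pose H s := G i s - G' i s.
have dH (x : R) : `|x| < 1 -> is_derive x 1 H (V (u x) 0 i - V (u' x) 0 i).
  by move=> x1; apply: is_deriveB; [exact: dG|exact: dG'].
have H0 : H 0 = 0 by rewrite /H G0 G0' subr0.
apply: le_trans (primitive_bound (a := L * C) H0 dH _ _) _.
- move=> x.
  have -> : V (u x) 0 i - V (u' x) 0 i = (V (u x) - V (u' x)) 0 i by rewrite !mxE.
  apply: le_trans (coord_le_norm _ _) _.
  apply: le_trans (V_lip (half (bu x)) (half (bu' x))) _.
  by rewrite ler_wpM2l.
- exact: le_lt_trans (clamp_le t) d1.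
- apply: (@le_trans _ _ (d * (L * C))).
    by rewrite ler_wpM2r// mulr_ge0.
  by rewrite mulrA mulrC ler_wpM2l.
Qed.

(** The iterates are Cauchy with the bound [r / 2 ^+ k], uniform in time, so their pointwise limit
    is continuous and admissible. By contraction its own iterate is also a limit of the sequence,
    hence equal to it. *)
Let fixed_point : exists2 z, adm z & step z z.
Proof.
have adm0 : adm (fun=> z0).
  split; first exact: cst_continuous.
  by move=> t; rewrite subrr normr0 divr_ge0// ltW.
(* Outside [adm] the operator is the identity, an arbitrary default; all iterates are shown to be
   admissible. *)
pose T u := if pselect (adm u) is left h then projT1 (cid (step_ex h)) else u.
have TP u : adm u -> step u (T u).
  by move=> au; rewrite /T; case: pselect => // h; exact: (projT2 (cid _)).
pose U k := iter k T (fun=> z0).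
have aU k : adm (U k) by elim: k => //= k IH; apply: step_adm (IH) (TP _ IH).
have B k j t : `|U (k + j)%N t - U k t| <= r / 2 ^+ k.
  elim: k j t => [|k IH] j t.
    rewrite expr0 divr1 add0n; apply: le_trans (_ : r / 2 <= r).
      by have [_] := aU j; apply.
    by have := r0; lra.
  rewrite exprSr invfM mulrA addSn /=.
  by apply: step_contract (aU (k + j)%N) (aU k) (TP _ _) (TP _ _) _ t.
have cvg0 : (fun k => r / 2 ^+ k) @ \oo --> (0 : R).
  have := @cvg_geometric R r 2^-1; rewrite /geometric/=.
  rewrite ger0_norm ?invr_ge0// => /(_ _); under eq_fun do rewrite exprVn; apply.
  by rewrite invf_lt1// ltr1n.
have C t : cvg ((fun k => U k t) @ \oo).
  apply/cauchy_cvgP/cauchy_exP => e e0.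
  have /cvgrPdist_lt/(_ e e0)[N _ HN] := cvg0.
  exists (U N t); exists N => // k /= Nk.
  rewrite -ball_normE/= distrC -(subnKC Nk).
  apply: le_lt_trans (B _ _ _) _.
  have := HN N (leqnn N); rewrite /= sub0r normrN; apply: le_lt_trans.
  exact: ler_norm.
pose z t := lim ((fun k => U k t) @ \oo).
have zU k t : `|z t - U k t| <= r / 2 ^+ k.
  have Cz : (fun j => `|U (j + k)%N t - U k t|) @ \oo --> `|z t - U k t|.
    apply: cvg_norm; apply: cvgB; last exact: cvg_cst.
    by have := C t; rewrite -(cvg_shiftn k).
  apply: (cvgr_to_le Cz); near=> j; by rewrite addnC.
have az : adm z.
  split.
    move=> t; apply/cvgrPdist_le => e e0.
    have e3 : 0 < e / 3 by rewrite divr_gt0.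
    have /cvgrPdist_lt/(_ _ e3)[N _ /(_ N (leqnn N))/=] := cvg0.
    rewrite sub0r normrN => HN.
    have {}HN : r / 2 ^+ N <= e / 3 by apply/ltW/(le_lt_trans _ HN)/ler_norm.
    have [cN _] := aU N.
    near=> s.
    have H1 : `|U N t - U N s| <= e / 3.
      by near: s; have /cvgrPdist_le := cN t; apply.
    have H2 := le_trans (zU N t) HN; have H3 := le_trans (zU N s) HN.
    rewrite (_ : z t - z s = (z t - U N t) + (U N t - U N s) - (z s - U N s)).
      have := ler_normB ((z t - U N t) + (U N t - U N s)) (z s - U N s).
      have := ler_normD (z t - U N t) (U N t - U N s).
      by lra.
    by rewrite addrA subrK opprB addrA subrK.
  move=> t.
  have Cz : (fun j => `|U j t - z0|) @ \oo --> `|z t - z0|.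
    by apply: cvg_norm; apply: cvgB; [exact: C|exact: cvg_cst].
  apply: (cvgr_to_le Cz); near=> j.
  by have [_] := aU j; apply.
exists z => //; have Sz := TP _ az.
suff E : T z = z by rewrite E in Sz.
apply/funext => t; apply/eqP; rewrite -subr_eq0 -normr_le0.
apply/ler_addgt0Pl => e e0; rewrite addr0.
have e2 : 0 < e / 2 by rewrite divr_gt0.
have /cvgrPdist_lt/(_ _ e2)[N _ HN] := cvg0.
have {}HN k : (N <= k)%N -> r / 2 ^+ k <= e / 2.
  move=> /HN; rewrite /= sub0r normrN => /ltW; apply: le_trans; exact: ler_norm.
have H1 : `|T z t - U N.+1 t| <= e / 2 / 2.
  apply: step_contract az (aU N) Sz (TP _ (aU N)) _ t => s.
  exact: le_trans (zU N s) (HN N (leqnn N)).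
have H2 := le_trans (zU N.+1 t) (HN N.+1 (leqnSn N)).
rewrite (_ : T z t - z t = (T z t - U N.+1 t) - (z t - U N.+1 t)).
  have := ler_normB (T z t - U N.+1 t) (z t - U N.+1 t).
  by move: H1 H2; lra.
by rewrite opprB addrA subrK.
Unshelve. all: by end_near. Qed.

(** The bound on [z t] holds for all times, not only small ones, because the solution depends on the
    clamped time and is frozen outside the interval. *)
Lemma Picard_Lindelof : exists2 e : R, 0 < e & exists z : R -> vec,
  [/\ z 0 = z0, forall t : R, `|z t - z0| < r &
      forall t : R, `|t| < e -> is_derive t 1 z (V (z t))].
Proof.
have [z [cz bz] [G GP zE]] := fixed_point.
exists d => //; exists z; split.
- rewrite zE; apply/rowP => i; rewrite !mxE clamp_id ?normr0//.
  by have [-> _] := GP i; rewrite addr0.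
- by move=> t; exact: half.
- move=> t td.
  have D : is_derive t 1 (fun s => \row_i (z0 0 i + G i s) : vec)
      (\row_i (0 + V (z t) 0 i)).
    apply: is_derive_row => i; apply: is_deriveD; have [_ +] := GP i; apply.
    exact: lt_trans td d1.
  have -> : V (z t) = \row_i (0 + V (z t) 0 i).
    by apply/rowP => i; rewrite mxE add0r.
  have zs s : z s = \row_i (z0 0 i + G i (clamp s)) by rewrite {1}zE.
  apply: near_eq_is_derive D.
  near=> s; rewrite zs clamp_id//; near: s.
  by apply: cvgr_norm_lt td; exact: cvg_id.
Unshelve. all: by end_near. Qed.

End Picard.

Lemma is_derive_pair (R : realType) (V W : normedModType R)
    (c1 : R -> V) (c2 : R -> W) (t : R) (v1 : V) (v2 : W) :
  is_derive t 1 c1 v1 -> is_derive t 1 c2 v2 ->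
  is_derive t 1 (fun s => (c1 s, c2 s)) (v1, v2).
Proof.
move=> [d1 <-] [d2 <-].
have d1' : differentiable c1 t by apply/derivable1_diffP.
have d2' : differentiable c2 t by apply/derivable1_diffP.
have d12 := differentiable_pair d1' d2'.
apply: DeriveDef; first exact: diff_derivable.
by rewrite !deriveE// diff_pair.
Qed.

Lemma is_derive_affine (R : realType) (V : normedModType R) (p v : V) (t : R) :
  is_derive t 1 (fun t : R => p + t *: v) v.
Proof.
have := @is_derive_line _ _ _ id p v t.
by rewrite derive_id; apply; exact: derivable_id.
Qed.

(** * Calculus on the slit tangent bundle *)

Section ProductDerivatives.
Context {R : realType} {n : nat}.
Local Notation vec := 'rV[R]_n.
Implicit Types (g : vec * vec -> R) (u v x y : vec) (z : vec * vec).

(** With [horiz], [vert] and [unc], partial derivatives in position and in velocity become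
    directional derivatives of one function on a product, where [Schwarz] covers the mixed ones. *)
Definition horiz u : vec * vec := (u, 0).
Definition vert v : vec * vec := (0, v).
Definition unc (G : vec -> vec -> R) : vec * vec -> R := fun z => G z.1 z.2.

Lemma derive_horiz (G : vec -> vec -> R) u x y :
  'D_u (G ^~ y) x = 'D_(horiz u) (unc G) (x, y).
Proof.
rewrite /derive; set d1 := (fun _ : R => _); set d2 := (fun _ : R => _).
suff -> : d1 = d2 by [].
by apply/funext => h; rewrite /d1 /d2 /unc /= scaler0 add0r.
Qed.

Lemma derive_vert (G : vec -> vec -> R) v x y :
  'D_v (G x) y = 'D_(vert v) (unc G) (x, y).
Proof.
rewrite /derive; set d1 := (fun _ : R => _); set d2 := (fun _ : R => _).
suff -> : d1 = d2 by [].
by apply/funext => h; rewrite /d1 /d2 /unc /= scaler0 add0r.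
Qed.

Lemma derivable_horiz (G : vec -> vec -> R) u x y :
  derivable (unc G) (x, y) (horiz u) -> derivable (G ^~ y) x u.
Proof.
rewrite /derivable; set d1 := (fun _ : R => _); set d2 := (fun _ : R => _).
suff -> : d1 = d2 by [].
by apply/funext => h; rewrite /d1 /d2 /unc /= scaler0 add0r.
Qed.

Lemma dxE k (G : vec -> vec -> R) : unc (dx k G) = 'D_(horiz (delta_mx 0 k)) (unc G).
Proof. by apply/funext => -[x y]; rewrite {1}/unc /dx /partial derive_horiz. Qed.

Lemma dyE k (G : vec -> vec -> R) : unc (dy k G) = 'D_(vert (delta_mx 0 k)) (unc G).
Proof. by apply/funext => -[x y]; rewrite {1}/unc /dy /partial derive_vert. Qed.

Lemma fst_sum (I : Type) (s : seq I) (G : I -> vec * vec) :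
  (\sum_(k <- s) G k).1 = \sum_(k <- s) (G k).1.
Proof. by rewrite raddf_sum. Qed.

Lemma snd_sum (I : Type) (s : seq I) (G : I -> vec * vec) :
  (\sum_(k <- s) G k).2 = \sum_(k <- s) (G k).2.
Proof. by rewrite raddf_sum. Qed.

Lemma horiz_sum u : horiz u = \sum_i u 0 i *: horiz (delta_mx 0 i).
Proof.
rewrite [RHS]surjective_pairing fst_sum snd_sum /= -row_sum_delta.
by rewrite big1// => i _; rewrite scaler0.
Qed.

Lemma vert_sum u : vert u = \sum_i u 0 i *: vert (delta_mx 0 i).
Proof.
rewrite [RHS]surjective_pairing fst_sum snd_sum /= -row_sum_delta.
by rewrite big1// => i _; rewrite scaler0.
Qed.

Lemma vertD (a : R) u v : vert (a *: u + v) = a *: vert u + vert v.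
Proof. by rewrite [RHS]surjective_pairing /= scaler0 addr0. Qed.

(** Linearity in the inner direction: [Schwarz] moves it outside, where differentiability of
    ['D_w g] expands it, and moves each term back. *)
Lemma derive2_lin_sum (U : set (vec * vec)) g z w (I : Type) (s : seq I)
    (a : I -> R) (e : I -> vec * vec) : open U -> smooth U g -> U z ->
  'D_w ('D_(\sum_(i <- s) a i *: e i) g) z = \sum_(i <- s) a i * 'D_w ('D_(e i) g) z.
Proof.
move=> oU sg Uz; rewrite (Schwarz _ _ oU sg Uz) derive_lin_sum.
  by apply: eq_bigr => i _; rewrite (Schwarz _ _ oU sg Uz).
have sD := smooth_derive w sg.
apply: prod_C1_differentiable Uz => // v y; first exact: (smooth_derivable sD).
exact: (smooth_continuous (smooth_derive v sD)).
Qed.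

End ProductDerivatives.

(** * The slit tangent bundle, homogeneous functions and Euler's identity *)

Section Homogeneity.
Context {R : realType} {n : nat}.
Local Notation vec := 'rV[R]_n.
Variable Omega : set vec.
Hypothesis oO : open Omega.
Implicit Types (g : vec * vec -> R) (u v x y : vec) (z : vec * vec).

Lemma open_nonzero : open [set y : vec | y != 0].
Proof.
have -> : [set y : vec | y != 0] = ~` [set 0].
  by apply/seteqP; split => y /= /eqP.
apply/closed_openC/accessible_closed_set1/hausdorff_accessible/norm_hausdorff.
Qed.

Definition slit : set (vec * vec) := [set z | Omega z.1 /\ z.2 != 0].

Lemma open_slit : open slit.
Proof.
have -> : slit = fst @^-1` Omega `&` snd @^-1` [set y : vec | y != 0] by [].
apply: openI; apply: open_comp => //.
- by move=> z _; exact: cvg_fst.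
- by move=> z _; exact: cvg_snd.
- exact: open_nonzero.
Qed.

Lemma slitP x y : Omega x -> y != 0 -> slit (x, y).
Proof. by []. Qed.

Lemma smooth_differentiable g z : smooth slit g -> slit z -> differentiable g z.
Proof.
move=> sg Uz; apply: prod_C1_differentiable Uz => [|v y|v y]; first exact: open_slit.
  exact: (smooth_derivable sg).
exact: (smooth_continuous (smooth_derive v sg)).
Qed.

Definition homog (r : nat) g := forall x y (a : R), Omega x -> y != 0 -> 0 < a ->
  g (x, a *: y) = a ^+ r * g (x, y).

Lemma homog_horiz r g u : smooth slit g -> homog r g -> homog r ('D_(horiz u) g).
Proof.
move=> sg hg x y a Ox y0 a0.
have E w : 'D_(horiz u) g (x, w) = 'D_u (fun x' => g (x', w)) x.
  by rewrite (derive_horiz (fun x y => g (x, y))); congr ('D_ _ _ _); apply/funext => -[].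
rewrite !E; transitivity ('D_u (fun x' => a ^+ r * g (x', y)) x).
  by apply: (derive_ext_on _ oO) Ox => x' Ox'; exact: hg.
rewrite deriveMl//.
apply: (@derivable_horiz _ _ (fun x y => g (x, y))).
rewrite (_ : unc _ = g); last by apply/funext => -[].
exact: smooth_derivable sg (slitP Ox y0).
Qed.

(** Differentiate the homogeneity relation at [y + t *: v] at [t = 0] and cancel one factor [a]. The
    relation is only available for small [t], where [y + t *: v] is nonzero. *)
Lemma homog_vert r g v : smooth slit g -> homog r.+1 g -> homog r ('D_(vert v) g).
Proof.
move=> sg hg x y a Ox y0 a0.
have ay0 : a *: y != 0 by rewrite scaler_eq0 negb_or gt_eqF.
have line w (b : R) : is_derive (0 : R) 1 (fun t : R => b *: w + (b * t) *: v) (b *: v).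
  have -> : (fun t : R => b *: w + (b * t) *: v) = (fun t => b *: w + t *: (b *: v)).
    by apply/funext => t; rewrite scalerA mulrC.
  exact: is_derive_affine.
have D1 : is_derive (0 : R) 1 (fun t : R => g (x, a *: y + (a * t) *: v))
    ('D_(a *: vert v) g (x, a *: y)).
  have E : a *: vert v = (0, a *: v) by rewrite /vert [LHS]surjective_pairing/= scaler0.
  have := @is_derive_curve _ _ g (fun t : R => (x, a *: y + (a * t) *: v)) 0 (0, a *: v).
  rewrite E mulr0 scale0r addr0; apply.
    by apply: smooth_differentiable.
  exact: (@is_derive_pair R _ _ (fun=> x) _ 0 0 _ (is_derive_cst x (0 : R) 1) (line y a)).
have D2 : is_derive (0 : R) 1 (fun t : R => a ^+ r.+1 * g (x, y + t *: v))
    (a ^+ r.+1 * 'D_(vert v) g (x, y)).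
  have E (t : R) : (x, y + t *: v) = (x, y) + t *: vert v.
    by rewrite [RHS]surjective_pairing/= scaler0 addr0.
  have -> : (fun t : R => a ^+ r.+1 * g (x, y + t *: v)) =
      (fun t => a ^+ r.+1 * g ((x, y) + t *: vert v)).
    by apply/funext => t; rewrite E.
  have := @is_derive_line _ _ _ g (x, y) (vert v) 0.
  rewrite scale0r addr0 => /(_ (smooth_derivable sg (slitP Ox y0))) H.
  exact: is_deriveZ.
have NE : \forall t \near (0 : R),
    g (x, a *: y + (a * t) *: v) = a ^+ r.+1 * g (x, y + t *: v).
  have H : \forall t \near (0 : R), y + t *: v != 0.
    have C : (fun t : R => y + t *: v) @ (0 : R) --> y + (0 : R) *: v.
      by apply: cvgD; [exact: cvg_cst|apply: cvgZr_tmp; exact: cvg_id].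
    rewrite scale0r addr0 in C; apply: (C [set w | w != 0]).
    by apply: open_nbhs_nbhs; split => //; exact: open_nonzero.
  apply: filterS H => t yt; rewrite -hg//; congr (g (_, _)).
  by rewrite scalerDr scalerA.
have [_ E1] := D1; have [_ E2] := near_eq_is_derive (filterS (fun _ e => esym e) NE) D2.
move: E2; rewrite E1 exprS -mulrA.
have := @derive_linear _ _ g (x, a *: y) a (vert v) 0.
rewrite addr0 derive0 addr0 => -> //; last exact: smooth_differentiable.
by move=> /(mulfI (lt0r_neq0 a0)).
Qed.

(** Along the ray through [y] the function is [(1 + t) ^+ r] times its value at [y]; the identity is
    the derivative of this at [t = 0]. *)
Lemma Euler r g x y : smooth slit g -> homog r g -> Omega x -> y != 0 ->
  'D_(vert y) g (x, y) = r%:R * g (x, y).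
Proof.
move=> sg hg Ox y0.
have := @is_derive_line _ _ _ g (x, y) (vert y) 0.
have E (t : R) : (x, y) + t *: vert y = (x, (1 + t) *: y).
  by rewrite [LHS]surjective_pairing/= scaler0 addr0 scalerDl scale1r.
rewrite scale0r addr0 => /(_ (smooth_derivable sg (slitP Ox y0))) [_ <-].
have H : \forall t \near (0 : R), g ((x, y) + t *: vert y) = (1 + t) ^+ r * g (x, y).
  near=> t; rewrite E hg//.
  have : `|t| < 1 by near: t; apply: cvgr_norm_lt; [exact: cvg_id|rewrite normr0].
  by rewrite ltr_norml => /andP[? _]; lra.
rewrite (near_eq_derive _ H).
have D : is_derive (0 : R) 1 (fun t : R => 1 + t) 1.
  by have := is_deriveD (is_derive_cst (1 : R) (0 : R) 1) (is_derive_id (0 : R) 1); rewrite add0r.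
have -> : (fun t : R => (1 + t) ^+ r * g (x, y)) =
    (fun t : R => 1 + t) ^+ r * cst (g (x, y)).
  by apply/funext => t; rewrite fctE exprfctE.
have [_ ->] := is_deriveM (is_deriveX r D) (is_derive_cst (g (x, y)) (0 : R) 1).
rewrite scaler0 add0r addr0 expr1n /GRing.scale/= !mulr1 mulrC.
by [].
Unshelve. all: by end_near. Qed.

End Homogeneity.

Opaque derive.

Lemma continuous_pair (T V W : topologicalType) (c1 : T -> V) (c2 : T -> W) x :
  {for x, continuous c1} -> {for x, continuous c2} ->
  {for x, continuous (fun s => (c1 s, c2 s))}.
Proof. by move=> h1 h2; apply: (@cvg_pair _ _ _ _ (nbhs (c1 x)) (nbhs (c2 x))). Qed.

Section CoordinateSums.
Context {R : realType} {n : nat}.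
Local Notation vec := 'rV[R]_n.
Variable Omega : set vec.
Hypothesis oO : open Omega.
Variables (g : vec * vec -> R) (z : vec * vec).
Hypotheses (sg : smooth (slit Omega) g) (Uz : slit Omega z).
Local Notation e i := (delta_mx 0 i : vec).

Lemma derive_vert_sum v : 'D_(vert v) g z = \sum_i v 0 i * 'D_(vert (e i)) g z.
Proof. by rewrite {1}vert_sum derive_lin_sum//; exact: (smooth_differentiable oO sg). Qed.

Lemma derive_horiz_sum v : 'D_(horiz v) g z = \sum_i v 0 i * 'D_(horiz (e i)) g z.
Proof. by rewrite {1}horiz_sum derive_lin_sum//; exact: (smooth_differentiable oO sg). Qed.

Lemma derive2_vert_sum w v :
  'D_w ('D_(vert v) g) z = \sum_i v 0 i * 'D_w ('D_(vert (e i)) g) z.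
Proof. by rewrite {1}vert_sum (derive2_lin_sum _ _ _ _ (open_slit oO) sg Uz). Qed.

Lemma derive2_horiz_sum w v :
  'D_w ('D_(horiz v) g) z = \sum_i v 0 i * 'D_w ('D_(horiz (e i)) g) z.
Proof. by rewrite {1}horiz_sum (derive2_lin_sum _ _ _ _ (open_slit oO) sg Uz). Qed.

End CoordinateSums.

(** * Minkowski norms and the spray *)

Section Minkowski.
Context {R : realType} {n : nat}.
Local Notation vec := 'rV[R]_n.
Variables (Omega : set vec) (F : vec -> vec -> R).
Hypotheses (oO : open Omega) (HF : finsler_metric Omega F).
Local Notation f := (unc F).
Local Notation Q := (unc (sqF F)).
Local Notation U := (slit Omega).

Lemma F_smooth : smooth U f. Proof. by have [] := HF. Qed.

Lemma Q_smooth : smooth U Q.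
Proof.
by move=> k; apply: (CkM (open_slit oO) (F_smooth k) (F_smooth k)).
Qed.

Lemma F_ge0 x y : Omega x -> 0 <= F x y.
Proof. by move=> Ox; have [_ /(_ x Ox)[]] := HF. Qed.

Lemma F_eq0 x y : Omega x -> (F x y = 0) <-> (y = 0).
Proof. by move=> Ox; have [_ /(_ x Ox)[]] := HF. Qed.

Lemma F_gt0 x y : Omega x -> y != 0 -> 0 < F x y.
Proof.
move=> Ox y0; rewrite lt_def F_ge0// andbT; apply: contraNneq y0 => /F_eq0 ->//.
Qed.

Lemma F_homog : homog Omega 1 f.
Proof.
move=> x y a Ox _ a0; rewrite expr1 /unc/=.
by have [_ /(_ x Ox)[_ _ + _ _]] := HF; apply.
Qed.

Lemma Q_homog : homog Omega 2 Q.
Proof.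
move=> x y a Ox y0 a0; rewrite /unc/= /sqF.
by have := F_homog Ox y0 a0; rewrite /unc/= expr1 => ->; rewrite exprMn.
Qed.

Lemma F_scale0 x (v : vec) (a : R) : Omega x -> 0 <= a -> F x (a *: v) = a * F x v.
Proof.
move=> Ox; rewrite le_eqVlt => /orP[/eqP <-|a0].
  by rewrite scale0r mul0r; apply/F_eq0.
by have [_ /(_ x Ox)[_ _ + _ _]] := HF; apply.
Qed.

Lemma hessianE x y i j : hessian (fun w => F x w ^+ 2) y i j =
  'D_(vert (delta_mx 0 j)) ('D_(vert (delta_mx 0 i)) Q) (x, y).
Proof.
rewrite mxE -[LHS]/(unc (dy j (dy i (sqF F))) (x, y)).
by rewrite dyE dyE.
Qed.

Lemma hessian_quad x y v : Omega x -> y != 0 ->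
  (v *m hessian (fun w => F x w ^+ 2) y *m v^T) 0 0 =
  'D_(vert v) ('D_(vert v) Q) (x, y).
Proof.
move=> Ox y0; have Uz : U (x, y) by [].
rewrite (derive_vert_sum oO (smooth_derive _ Q_smooth) Uz).
have H j : (v *m hessian (fun w => F x w ^+ 2) y) 0 j =
    'D_(vert (delta_mx 0 j)) ('D_(vert v) Q) (x, y).
  rewrite (derive2_vert_sum oO Q_smooth Uz) mxE.
  by under eq_bigr do rewrite hessianE.
rewrite mxE; under eq_bigr do rewrite H.
by apply: eq_bigr => j _; rewrite mxE mulrC.
Qed.

Lemma posdef_D2 x y v : Omega x -> y != 0 -> v != 0 ->
  0 < 'D_(vert v) ('D_(vert v) Q) (x, y).
Proof.
move=> Ox y0 v0; rewrite -hessian_quad//.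
by have [_ /(_ x Ox)[_ _ _ _ +]] := HF; apply.
Qed.

Lemma Euler_F x y : Omega x -> y != 0 -> 'D_(vert y) f (x, y) = F x y.
Proof.
by move=> Ox y0; rewrite (Euler F_smooth F_homog Ox y0) mul1r.
Qed.

Lemma derive_Q x y (w : vec * vec) : Omega x -> y != 0 ->
  'D_w Q (x, y) = 2 * F x y * 'D_w f (x, y).
Proof.
move=> Ox y0.
have D : derivable f (x, y) w by apply: smooth_derivable F_smooth _.
have -> : Q = f * f by apply/funext => z; rewrite /unc /sqF /= expr2.
by rewrite (deriveM D D) /GRing.scale/=; rewrite {1 3}/unc/=; ring.
Qed.

(** On a segment avoiding 0 the square of the norm has positive second derivatives, so its tangent
    at [w] lies below its value at [v]. Euler's identity rewrites the slope in direction [v - w]. *)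
Lemma convex_Q x w v : Omega x ->
  (forall t : R, 0 <= t <= 1 -> w + t *: (v - w) != 0) ->
  2 * F x w * 'D_(vert v) f (x, w) <= F x v ^+ 2 + F x w ^+ 2.
Proof.
move=> Ox seg.
have i01 : (0 : R) <= (0 : R) <= (1 : R) by rewrite lexx ler01.
have w0 : w != 0 by have := seg 0 i01; rewrite scale0r addr0.
have E (t : R) : (x, w) + t *: vert (v - w) = (x, w + t *: (v - w)).
  by rewrite [LHS]surjective_pairing/= scaler0 addr0.
have [t t01|c c01] := @MVT_line _ _ Q (x, w) (vert (v - w)) 1.
  by rewrite E mulr1; apply: smooth_derivable Q_smooth _; split => //=; exact: seg.
rewrite !E mulr1 !mul1r scale1r (addrC w (v - w)) subrK => E1.
have c'01 (t : R) : 0 <= t <= 1 -> 0 <= t * c <= 1.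
  by move=> /andP[t0 t1]; case/andP: c01 => c0 c1; rewrite mulr_ge0// mulr_ile1.
have [t t01|d d01] := @MVT_line _ _ ('D_(vert (v - w)) Q) (x, w) (vert (v - w)) c.
  rewrite E; apply: smooth_derivable (smooth_derive _ Q_smooth) _.
  by split => //=; apply: seg; exact: c'01.
rewrite !E => E2.
have nn : 0 <= 'D_(vert (v - w)) Q (x, w + c *: (v - w)) - 'D_(vert (v - w)) Q (x, w).
  rewrite E2; case/andP: c01 => c0 c1; rewrite mulr_ge0//.
  have [vw0|vw0] := eqVneq (v - w) 0; first by rewrite vw0 derive0.
  by apply/ltW/posdef_D2 => //; apply: seg; exact: c'01.
have Dv : 'D_(vert (v - w)) f (x, w) = 'D_(vert v) f (x, w) - F x w.
  have -> : vert (v - w) = -1 *: vert w + vert v.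
    by rewrite -vertD scaleN1r addrC.
  rewrite derive_linear; last exact: (smooth_differentiable oO F_smooth).
  by rewrite Euler_F// mulN1r addrC.
have := derive_Q (vert (v - w)) Ox w0; rewrite Dv => E3.
move: nn; rewrite E3 -E1 /unc/= /sqF.
move: ('D_(vert v) f (x, w)) => a.
lra.
Qed.

(** Scale [v] by [l] to the norm of [w]: both squares in [convex_Q] then coincide and the linear
    inequality drops out after dividing by [F x w]. *)
Lemma fundamental_inequality x w v : Omega x -> w != 0 ->
  'D_(vert v) f (x, w) <= F x v.
Proof.
move=> Ox w0.
have [->|v0] := eqVneq v 0.
  by rewrite derive0 F_ge0.
have Fv := F_gt0 Ox v0; have Fw := F_gt0 Ox w0.
pose l := F x w / F x v.
have l0 : 0 < l by rewrite divr_gt0.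
have DZ (a : R) u : 'D_(vert (a *: u)) f (x, w) = a * 'D_(vert u) f (x, w).
  have := vertD a u 0; rewrite addr0 => ->.
  rewrite derive_linear; last exact: (smooth_differentiable oO F_smooth).
  by rewrite derive0 addr0.
have D := DZ l v.
case: (pselect (forall t : R, 0 <= t <= 1 -> w + t *: (l *: v - w) != 0)) => H.
  have := convex_Q Ox H; rewrite D F_scale0 ?(ltW l0)//.
  have -> : l * F x v = F x w by rewrite divfK// gt_eqF.
  move=> H1.
  have : F x w * (l * 'D_(vert v) f (x, w)) <= F x w * F x w by lra.
  by rewrite ler_pM2l// /l mulrAC ler_pdivrMr// ler_pM2l.
(* The segment from [w] to [l *: v] meets 0 only if [v] is a nonpositive multiple of [w]; then the
   left side is at most 0 by Euler's identity. *)
move/existsNP: H => [t /not_implyP[/andP[t0 t1] /negP]].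
rewrite negbK scalerBr addrCA scalerA -[X in _ + (X - _)]scale1r -scalerBl => /eqP E.
have tn0 : t != 0.
  by apply: contra_neq w0 => t0'; rewrite -E t0' mul0r scale0r add0r subr0 scale1r.
pose m := (1 - t) / (t * l).
have m0 : 0 <= m by rewrite divr_ge0 ?subr_ge0// mulr_ge0// ltW.
have Ev : v = (- m) *: w.
  have tl0 : t * l != 0 by rewrite mulf_neq0// gt_eqF.
  apply: (scalerI tl0).
  rewrite scalerA mulrN [_ * m]mulrC /m divfK// scaleNr.
  by apply/eqP; rewrite -addr_eq0 E.
have -> : 'D_(vert v) f (x, w) = - m * F x w.
  by rewrite Ev DZ Euler_F.
by apply: le_trans (ltW Fv); rewrite mulNr oppr_le0 mulr_ge0// ltW.
Qed.

(** By Euler's identity [F x (u + v)] is the vertical derivative at [u + v] in its own direction;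
    split it linearly and bound both terms. *)
Lemma F_triangle x u v : Omega x -> F x (u + v) <= F x u + F x v.
Proof.
move=> Ox; have [uv0|uv0] := eqVneq (u + v) 0.
  by rewrite uv0 (F_eq0 0 Ox).2// addr_ge0// F_ge0.
rewrite -Euler_F//.
have := vertD 1 u v; rewrite !scale1r => ->.
rewrite -[X in 'D_(X + _) _ _]scale1r derive_linear ?mul1r.
  by apply: lerD; exact: fundamental_inequality.
exact: (smooth_differentiable oO F_smooth).
Qed.

(** Homogeneity holds for positive factors only, so both signs of each basis vector are needed in
    the bound. *)
Lemma F_le_coord x y : Omega x -> F x y <=
  \sum_i `|y 0 i| * (F x (delta_mx 0 i) + F x (- delta_mx 0 i)).
Proof.
move=> Ox; rewrite {1}[y]row_sum_delta.
elim/big_ind2 : _ => [|u a v b Hu Hv|i _].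
- by rewrite (F_eq0 0 Ox).2.
- exact: le_trans (F_triangle _ _ Ox) (lerD Hu Hv).
rewrite mulrDr; case: (lerP 0 (y 0 i)) => yi.
  by rewrite F_scale0// ger0_norm// lerDl mulr_ge0// F_ge0.
rewrite -[X in F x X <= _]opprK -scalerN -scaleNr F_scale0 ?oppr_ge0//; last exact: ltW.
by rewrite ltr0_norm// lerDr mulr_ge0 ?F_ge0// oppr_ge0 ltW.
Qed.

(** The zero section is the point here: an admissible curve may have zero velocity, and its length
    integrand must still be continuous. There [F_le_coord] squeezes the norm, locally uniformly in
    the base point. *)
Lemma F_continuous x y : Omega x -> {for (x, y), continuous f}.
Proof.
move=> Ox; have [->|y0] := eqVneq y 0; last first.
  exact: smooth_continuous F_smooth _.
have e0 (i : 'I_n) : (delta_mx 0 i : vec) != 0.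
  by apply/eqP => /matrixP/(_ 0 i); rewrite !mxE !eqxx => /eqP; rewrite oner_eq0.
have Cv (v : vec) : v != 0 -> {for x, continuous (F ^~ v)}.
  move=> v0; apply: (@continuous_comp _ _ _ (fun x' => (x', v)) f).
    by apply: continuous_pair; [exact: cvg_id|exact: cst_continuous].
  exact: smooth_continuous F_smooth _.
have C : (fun z : vec * vec => \sum_i `|z.2 0 i| *
    (F z.1 (delta_mx 0 i) + F z.1 (- delta_mx 0 i))) @ (x, 0 : vec) --> (0 : R).
  rewrite -[X in _ --> X](@big1 _ 0 +%R _ (index_enum 'I_n) xpredT
    (fun i => `|(0 : vec) 0 i| * (F x (delta_mx 0 i) + F x (- delta_mx 0 i)))).
    apply: cvg_big => [|i _]; first exact: add_continuous.
    apply: cvgM.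
      apply: cvg_norm; apply: (@cvg_comp _ _ _ snd (fun v : vec => v 0 i) _ (nbhs (0 : vec))).
        exact: cvg_snd.
      exact: coord_continuous.
    apply: cvgD; apply: (@cvg_comp _ _ _ fst (F ^~ _) _ (nbhs x)); try exact: cvg_fst.
      exact: Cv.
    by apply: Cv; rewrite oppr_eq0.
  by move=> i _; rewrite mxE normr0 mul0r.
rewrite /prop_for /continuous_at /unc/= (F_eq0 0 Ox).2//.
apply/cvgrPdist_le => e e0'; move/cvgrPdist_le/(_ e e0') : C => C.
near=> z.
have Oz : Omega z.1.
  near: z; apply: cvg_fst; exact: open_nbhs_nbhs.
have : `|0 - \sum_i `|z.2 0 i| * (F z.1 (delta_mx 0 i) + F z.1 (- delta_mx 0 i))| <= e.
  by near: z.
rewrite !sub0r !normrN [X in _ -> X <= _]ger0_norm ?F_ge0//.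
by move=> /(le_trans (ler_norm _)); apply: le_trans; exact: F_le_coord.
Unshelve. all: by end_near. Qed.

End Minkowski.

Section LinearCoordinates.
Context {R : realType}.

Lemma is_derive_lin (V : normedModType R) (f : V -> R) x v :
  (forall x v (h : R), f (h *: v + x) = h * f v + f x) -> is_derive x v f (f v).
Proof.
Transparent derive.
move=> lf.
have L : (fun h : R => h^-1 *: (f (h *: v + x) - f x)) @ 0^' --> f v.
  apply: cvg_near_cst; near=> h.
  rewrite lf addrK /GRing.scale/= mulKf//.
  by near: h; exact: nbhs_dnbhs_neq.
apply: DeriveDef; last exact/cvg_lim.
by apply/cvg_ex; exists (f v).
Unshelve. all: by end_near. Qed.
Opaque derive.

Context {n : nat}.
Local Notation vec := 'rV[R]_n.

Lemma smooth_coord2 (U : set (vec * vec)) (k : 'I_n) :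
  smooth U (fun z : vec * vec => z.2 0 k).
Proof.
move=> m; apply: Ck_lin => [z|x v h]; last by rewrite !mxE.
apply: (@cvg_comp _ _ _ snd (fun v : vec => v 0 k) _ (nbhs z.2)).
  exact: cvg_snd.
exact: coord_continuous.
Qed.

Lemma is_derive_coord2 (z w : vec * vec) (k : 'I_n) :
  is_derive z w (fun z : vec * vec => z.2 0 k) (w.2 0 k).
Proof. by apply: is_derive_lin => x v h; rewrite !mxE. Qed.

Lemma is_derive_sum_coord (h : 'I_n -> vec * vec -> R) (z w : vec * vec) :
  (forall k, derivable (h k) z w) ->
  is_derive z w (fun z : vec * vec => \sum_k z.2 0 k * h k z)
    (\sum_k w.2 0 k * h k z + \sum_k z.2 0 k * 'D_w (h k) z).
Proof.
move=> dh.
have D k : is_derive z w (fun z : vec * vec => z.2 0 k * h k z)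
    (w.2 0 k * h k z + z.2 0 k * 'D_w (h k) z).
  have H := is_deriveM (is_derive_coord2 z w k) (derivableP (dh k)).
  by apply: is_derive_eq; rewrite /GRing.scale/= addrC (mulrC (h k z)).
have -> : (fun z : vec * vec => \sum_k z.2 0 k * h k z) =
    \sum_(k < n) (fun z : vec * vec => z.2 0 k * h k z).
  by apply/funext => y; rewrite fct_sumE.
by rewrite -big_split; apply: is_derive_sum.
Qed.

End LinearCoordinates.

Lemma eq_of_add_swap (R : realFieldType) (a b t : R) :
  a + t = b -> b + t = a -> a = b.
Proof. lra. Qed.

Opaque dx dy.

Section PartialDerivatives.
Context {R : realType} {n : nat}.
Local Notation vec := 'rV[R]_n.
Local Notation e i := (delta_mx 0 i : vec).

Lemma dx_unc (G : vec -> vec -> R) k x y : dx k G x y = 'D_(horiz (e k)) (unc G) (x, y).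
Proof. by rewrite -[LHS]/(unc (dx k G) (x, y)) dxE. Qed.

Lemma dy_unc (G : vec -> vec -> R) k x y : dy k G x y = 'D_(vert (e k)) (unc G) (x, y).
Proof. by rewrite -[LHS]/(unc (dy k G) (x, y)) dyE. Qed.

Lemma dy_dx_unc (G : vec -> vec -> R) j k x y :
  dy j (dx k G) x y = 'D_(vert (e j)) ('D_(horiz (e k)) (unc G)) (x, y).
Proof. by rewrite dy_unc dxE. Qed.

Lemma dy_dy_unc (G : vec -> vec -> R) j k x y :
  dy j (dy k G) x y = 'D_(vert (e j)) ('D_(vert (e k)) (unc G)) (x, y).
Proof. by rewrite dy_unc dyE. Qed.

End PartialDerivatives.

Lemma uncE (R : realType) n (G : 'rV[R]_n -> 'rV[R]_n -> R) x y : unc G (x, y) = G x y.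
Proof. by []. Qed.

Lemma vert2 (R : realType) n (v : 'rV[R]_n) : (vert v).2 = v.
Proof. by []. Qed.

Opaque horiz vert unc sqF.

(** * The spray, Hamel's equations and closedness *)

Section Spray.
Context {R : realType} {n : nat}.
Local Notation vec := 'rV[R]_n.
Variables (Omega : set vec) (F : vec -> vec -> R).
Hypotheses (oO : open Omega) (HF : finsler_metric Omega F).
Local Notation f := (unc F).
Local Notation Q := (unc (sqF F)).
Local Notation U := (slit Omega).
Local Notation e i := (delta_mx 0 i : vec).
Local Notation Qs := (Q_smooth oO HF).
Local Notation Fs := (F_smooth HF).

Definition spray_vec x y : vec := \row_i spray_coef F i x y.

Lemma fundamentalE x y i j : fundamental_tensor F x y i j =
  2^-1 * 'D_(vert (e j)) ('D_(vert (e i)) Q) (x, y).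
Proof.
by rewrite mxE dy_dy_unc.
Qed.

Lemma innerE x y u v : Omega x -> y != 0 -> inner F x y u v =
  2^-1 * 'D_(vert v) ('D_(vert u) Q) (x, y).
Proof.
move=> Ox y0; have Uz : U (x, y) by [].
rewrite (derive_vert_sum oO (smooth_derive _ Qs) Uz).
have H j : (u *m fundamental_tensor F x y) 0 j =
    2^-1 * 'D_(vert (e j)) ('D_(vert u) Q) (x, y).
  rewrite (derive2_vert_sum oO Qs Uz) mxE mulr_sumr.
  by apply: eq_bigr => i _; rewrite fundamentalE mulrCA.
rewrite /inner mxE mulr_sumr; apply: eq_bigr => j _.
by rewrite H mxE mulrC mulrCA.
Qed.

Lemma fundamental_sym x y : Omega x -> y != 0 ->
  (fundamental_tensor F x y)^T = fundamental_tensor F x y.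
Proof.
move=> Ox y0; apply/matrixP => i j; rewrite mxE !fundamentalE.
by rewrite (Schwarz _ _ (open_slit oO) Qs).
Qed.

Lemma inner_gt0 x y u : Omega x -> y != 0 -> u != 0 -> 0 < inner F x y u u.
Proof.
by move=> Ox y0 u0; rewrite innerE// mulr_gt0 ?invr_gt0// (posdef_D2 oO HF).
Qed.

Lemma fundamental_unit x y : Omega x -> y != 0 -> fundamental_tensor F x y \in unitmx.
Proof.
move=> Ox y0; rewrite -row_free_unit; apply: inj_row_free => v vg.
apply/eqP; apply: contraT => v0.
by have := inner_gt0 Ox y0 v0; rewrite /inner vg mul0mx mxE ltxx.
Qed.

(** Pairing with the metric cancels its inverse, so later arguments can avoid [invmx]. The symmetry
    of the metric reconciles the column convention of [spray_coef] with row vectors. *)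
Lemma spray_vecE x y v : Omega x -> y != 0 ->
  inner F x y (spray_vec x y) v =
  4^-1 * ('D_(vert v) ('D_(horiz y) Q) (x, y) - 'D_(horiz v) Q (x, y)).
Proof.
move=> Ox y0; have Uz : U (x, y) by [].
pose b : vec := \row_j ('D_(vert (e j)) ('D_(horiz y) Q) (x, y) - 'D_(horiz (e j)) Q (x, y)).
have sprayb : spray_vec x y = 4^-1 *: (b *m invmx (fundamental_tensor F x y)).
  have gs : (invmx (fundamental_tensor F x y))^T = invmx (fundamental_tensor F x y).
    by rewrite trmx_inv fundamental_sym.
  have bE j : (\sum_k dy j (dx k (sqF F)) x y * y 0 k) - dx j (sqF F) x y = b 0 j.
    rewrite mxE dx_unc (derive2_horiz_sum oO Qs Uz).
    by under eq_bigr do rewrite dy_dx_unc mulrC.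
  apply/rowP => i; rewrite mxE /spray_coef; under eq_bigr do rewrite bE.
  rewrite mxE; congr (_ * _); rewrite mxE.
  have gsE j : invmx (fundamental_tensor F x y) j i = invmx (fundamental_tensor F x y) i j.
    by rewrite -{1}gs mxE.
  by apply: eq_bigr => j _; rewrite gsE mulrC.
rewrite /inner sprayb -scalemxAl mulmxKV ?fundamental_unit// -scalemxAl !mxE.
congr (_ * _).
rewrite (derive_vert_sum oO (smooth_derive _ Qs) Uz) (derive_horiz_sum oO Qs Uz).
by rewrite -sumrB; apply: eq_bigr => j _; rewrite !mxE mulrC mulrBr.
Qed.

Lemma vert_Euler2 x y v : Omega x -> y != 0 ->
  'D_(vert y) ('D_(vert v) Q) (x, y) = 'D_(vert v) Q (x, y).
Proof.
move=> Ox y0.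
have h : homog Omega 1 ('D_(vert v) Q) := homog_vert oO v Qs (Q_homog HF).
by rewrite (Euler (smooth_derive _ Qs) h Ox y0) mul1r.
Qed.

Lemma horiz_Euler2 x y v : Omega x -> y != 0 ->
  'D_(vert y) ('D_(horiz v) Q) (x, y) = 2 * 'D_(horiz v) Q (x, y).
Proof.
move=> Ox y0.
have h : homog Omega 2 ('D_(horiz v) Q) := homog_horiz oO v Qs (Q_homog HF).
by rewrite (Euler (smooth_derive _ Qs) h Ox y0).
Qed.

(** Infinitesimal conservation of energy: the derivative of the squared norm along [(y, -2 G)]
    vanishes. It is [spray_vecE] with [v = y], simplified by Euler's identity. *)
Lemma spray_energy x y : Omega x -> y != 0 ->
  2 * 'D_(vert (spray_vec x y)) Q (x, y) = 'D_(horiz y) Q (x, y).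
Proof.
move=> Ox y0; have := spray_vecE y Ox y0.
rewrite innerE// vert_Euler2// horiz_Euler2//.
move: ('D_(vert (spray_vec x y)) Q (x, y)) ('D_(horiz y) Q (x, y)) => a b; lra.
Qed.

Lemma spray_coefE i x y : spray_coef F i x y =
  4^-1 * \sum_j invmx (fundamental_tensor F x y) i j *
  ((\sum_k 'D_(vert (e j)) ('D_(horiz (e k)) Q) (x, y) * y 0 k)
    - 'D_(horiz (e j)) Q (x, y)).
Proof.
rewrite /spray_coef; under eq_bigr => j _.
  rewrite dx_unc; under eq_bigr do rewrite dy_dx_unc.
  over.
by [].
Qed.

Lemma smooth_spray i : smooth U (unc (spray_coef F i)).
Proof.
move=> k.
pose ks z := \sum_j invmx (fundamental_tensor F z.1 z.2) i j *
  ((\sum_m 'D_(vert (e j)) ('D_(horiz (e m)) Q) z * z.2 0 m) - 'D_(horiz (e j)) Q z).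
have E : unc (spray_coef F i) = fun z => 4^-1 * ks z.
  by apply/funext => -[x y]; rewrite /ks -spray_coefE.
have oU := open_slit oO.
rewrite E; apply: CkM => //; first exact: Ck_cst.
apply: Ck_sum => // j _; apply: CkM => //.
  apply: Ck_invmx => //.
    by move=> z [Oz z0]; exact: fundamental_unit.
  move=> i' j'.
  have -> : (fun z => fundamental_tensor F z.1 z.2 i' j') =
      fun z => 2^-1 * 'D_(vert (e j')) ('D_(vert (e i')) Q) z.
    by apply/funext => z; rewrite fundamentalE -surjective_pairing.
  apply: CkM => //; first exact: Ck_cst.
  by apply: smooth_derive; apply: smooth_derive; exact: Qs.
apply: CkD => //.
  apply: Ck_sum => // m _; apply: CkM => //; last exact: smooth_coord2.
  by apply: smooth_derive; apply: smooth_derive; exact: Qs.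
by apply: CkN => //; apply: smooth_derive; exact: Qs.
Qed.

Lemma projective_factorE x y : Omega x -> y != 0 ->
  projective_factor F x y = 'D_(horiz y) f (x, y) / (2 * F x y).
Proof.
move=> Ox y0; rewrite /projective_factor; congr (_ / _).
rewrite (derive_horiz_sum oO Fs (slitP Ox y0)); by under eq_bigr do rewrite dx_unc.
Qed.

(** The form in which flatness is used from here on; [flat_radial] derives it from the lines that
    contain the geodesics. *)
Hypothesis radial : forall x y, Omega x -> y != 0 ->
  exists l : R, spray_vec x y = l *: y.

Let radial_eq x y v (l : R) : Omega x -> y != 0 -> spray_vec x y = l *: y ->
  2 * l * 'D_(vert v) Q (x, y) =
  'D_(vert v) ('D_(horiz y) Q) (x, y) - 'D_(horiz v) Q (x, y).
Proof.
move=> Ox y0 E; have := spray_vecE v Ox y0; rewrite E.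
have -> : inner F x y (l *: y) v = l * inner F x y y v.
  by rewrite /inner -!scalemxAl !mxE.
rewrite innerE// (Schwarz (vert v) (vert y) (open_slit oO) Qs (slitP Ox y0)) vert_Euler2//.
move: ('D_(vert v) Q (x, y)) ('D_(vert v) ('D_(horiz y) Q) (x, y) - _) => a b; lra.
Qed.

(** Taking [v = y] in [radial_eq] determines the factor, since Euler's identity evaluates every
    term. *)
Lemma spray_projective x y : Omega x -> y != 0 ->
  spray_vec x y = projective_factor F x y *: y.
Proof.
move=> Ox y0; have [l E] := radial Ox y0; rewrite E; congr (_ *: _).
have := radial_eq y Ox y0 E; rewrite horiz_Euler2//.
rewrite (Euler Qs (Q_homog HF) Ox y0) (derive_Q HF _ Ox y0).
rewrite projective_factorE// uncE.
have -> : sqF F x y = F x y ^+ 2 by [].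
have Fxy := F_gt0 HF Ox y0.
move: ('D_(horiz y) f (x, y)) (F x y) Fxy => a b b0 H.
have bn : b != 0 by rewrite gt_eqF.
have bn2 : 2 * b != 0 by rewrite mulf_neq0.
by apply: (mulIf bn2); rewrite divfK//; apply: (mulfI bn); lra.
Qed.

(** Write the square as a product in [radial_eq]: the terms containing the vertical derivative of
    the norm cancel by the value of the projective factor, and the rest is divisible by [F x y]. *)
Lemma Hamel x y v : Omega x -> y != 0 ->
  'D_(vert v) ('D_(horiz y) f) (x, y) = 'D_(horiz v) f (x, y).
Proof.
move=> Ox y0; have Uz := slitP Ox y0; have oU := open_slit oO.
have := radial_eq v Ox y0 (spray_projective Ox y0).
rewrite projective_factorE// !(derive_Q HF _ Ox y0).
have E2 : 'D_(vert v) ('D_(horiz y) Q) (x, y) =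
    'D_(vert v) (fun z => 2 * (f z * 'D_(horiz y) f z)) (x, y).
  apply: (derive_ext_on _ oU) Uz => z [Oz z0].
  by rewrite [z]surjective_pairing (derive_Q HF _ Oz z0) mulrA.
have dF : derivable f (x, y) (vert v) := smooth_derivable Fs Uz.
have dF2 : derivable ('D_(horiz y) f) (x, y) (vert v) :=
  smooth_derivable (smooth_derive _ Fs) Uz.
have [_ E3] := is_deriveZ 2 (is_deriveM (derivableP dF) (derivableP dF2)).
rewrite (etrans E2 E3) /GRing.scale/= {E2 E3}.
have Fxy := F_gt0 HF Ox y0.
rewrite uncE; move: ('D_(vert v) f (x, y)) ('D_(horiz v) f (x, y))
  ('D_(vert v) ('D_(horiz y) f) (x, y)) ('D_(horiz y) f (x, y)) (F x y) Fxy => a b c d k k0.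
have kn : k != 0 by rewrite gt_eqF.
have -> : 2 * (d / (2 * k)) * (2 * k * a) = 2 * d * a by field.
move=> H; apply: (mulfI kn); lra.
Qed.

(* Differentiating Hamel's equations vertically gives a + t = b and b + t = a for the
   two mixed derivatives a and b, with the same third-order term t. *)
Lemma Hamel_closed z u v : U z ->
  'D_(horiz u) ('D_(vert v) f) z = 'D_(horiz v) ('D_(vert u) f) z.
Proof.
move=> Uz; have oU := open_slit oO.
pose T u v := \sum_k z.2 0 k * 'D_(vert u) ('D_(vert v) ('D_(horiz (e k)) f)) z.
have H u' v' : 'D_(vert v') ('D_(horiz u') f) z + T u' v' = 'D_(vert u') ('D_(horiz v') f) z.
  have s1 k : smooth U ('D_(vert v') ('D_(horiz (e k)) f)).
    by do 2!apply: smooth_derive; exact: Fs.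
  have E : 'D_(vert u') ('D_(horiz v') f) z = 'D_(vert u') (fun z : vec * vec =>
      \sum_k z.2 0 k * 'D_(vert v') ('D_(horiz (e k)) f) z) z.
    apply: (derive_ext_on _ oU) Uz => w Uw.
    rewrite -(derive2_horiz_sum oO Fs Uw); case: w Uw => wx wy [Ow w0].
    by rewrite /= Hamel.
  have [|_ D] := @is_derive_sum_coord _ _ (fun k => 'D_(vert v') ('D_(horiz (e k)) f)) z (vert u').
    by move=> k; exact: smooth_derivable (s1 k) Uz.
  rewrite vert2 in D.
  have A := derive2_horiz_sum oO Fs Uz (vert v') u'.
  exact: etrans (congr1 (+%R^~ (T u' v')) A) (esym (etrans E D)).
have S k := Schwarz (vert v) (vert u) oU (smooth_derive (horiz (e k)) Fs) Uz.
have Tsym : T v u = T u v := eq_bigr _ (fun k _ => congr1 ( *%R (z.2 0 k)) (S k)).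
have Hvu := etrans (congr1 (+%R _) (esym Tsym)) (H v u).
apply: etrans (Schwarz (horiz u) (vert v) oU Fs Uz) _.
apply: etrans (eq_of_add_swap (H u v) Hvu) _.
exact: esym (Schwarz (horiz v) (vert u) oU Fs Uz).
Qed.

End Spray.

(** * Geodesics and flatness *)

Section LocalLipschitz.
Context {R : realType} {n : nat}.
Local Notation vec := 'rV[R]_n.
Local Notation e i := (delta_mx 0 i : vec).

Lemma pair_horiz_vert (w : vec * vec) : w = horiz w.1 + vert w.2.
Proof.
Transparent horiz vert.
by rewrite [RHS]surjective_pairing /= addr0 add0r; case: w.
Qed.
Opaque horiz vert.

(** [S] sums the absolute values of all partial derivatives of all [g i]. It stays below [S z0 + 1]
    near [z0], which gives one radius and one constant for the whole family. *)
Lemma local_lipschitz (Omega : set vec) (I : finType) (g : I -> vec * vec -> R)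
    (z0 : vec * vec) : open Omega ->
  (forall i, smooth (slit Omega) (g i)) -> slit Omega z0 ->
  exists2 r : R, 0 < r & exists2 L : R, 0 <= L &
    ball z0 r `<=` slit Omega /\
    forall i a b, ball z0 r a -> ball z0 r b -> `|g i a - g i b| <= L * `|a - b|.
Proof.
move=> oO sg Uz0; have oU := open_slit oO.
pose S z := \sum_i \sum_k (`|'D_(horiz (e k)) (g i) z| + `|'D_(vert (e k)) (g i) z|).
have cS : {for z0, continuous S}.
  apply: cvg_big => [|i _]; first exact: add_continuous.
  apply: cvg_big => [|k _]; first exact: add_continuous.
  apply: cvgD; apply: cvg_norm; exact: (smooth_continuous (smooth_derive _ (sg i)) Uz0).
have N : \forall z \near z0, slit Omega z /\ `|S z0 - S z| <= 1.
  apply: filterI; first exact: open_nbhs_nbhs.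
  by have /cvgrPdist_le := cS; apply.
have /nbhs_ballP[r /= r0 br] := N.
have S0 z : 0 <= S z by apply: sumr_ge0 => i _; apply: sumr_ge0 => k _; rewrite addr_ge0.
exists r => //; exists (S z0 + 1); first by rewrite addr_ge0.
split=> [z /br[]//|i a b za zb].
have seg (t : R) : 0 <= t <= 1 -> ball z0 r (b + t *: (a - b)).
  move=> /andP[t0 t1]; move: za zb; rewrite -!ball_normE/= => za zb.
  have -> : z0 - (b + t *: (a - b)) = (1 - t) *: (z0 - b) + t *: (z0 - a).
    rewrite scalerBl scale1r -addrA [- (t *: _) + _]addrC -scalerBr opprD addrA.
    by rewrite -scalerN !opprB [z0 - a + _]addrC addrA subrK.
  apply: le_lt_trans (ler_normD _ _) _.
  rewrite !normrZ (ger0_norm t0) ger0_norm ?subr_ge0//.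
  have [->|tn0] := eqVneq t 0; first by rewrite subr0 mul1r mul0r addr0.
  have tp : 0 < t by rewrite lt_def tn0.
  have -> : r = (1 - t) * r + t * r by rewrite -mulrDl subrK mul1r.
  apply: ler_ltD; first by rewrite ler_wpM2l ?subr_ge0// ltW.
  by rewrite ltr_pM2l.
have [t t01|c c01] := @MVT_line _ _ (g i) b (a - b) 1.
  have [Ut _] := br _ (seg t t01).
  by rewrite mulr1; exact: smooth_derivable (sg i) Ut.
rewrite scale1r (addrC b (a - b)) subrK mulr1 mul1r => ->.
have [Uc Sc] := br _ (seg c c01); set z := b + _ in Uc Sc *.
have bound (w : vec * vec) : `|'D_w (g i) z| <= S z * `|w|.
  have dg : differentiable (g i) z by exact: smooth_differentiable (sg i) Uc.
  rewrite {1}[w]pair_horiz_vert -[horiz _]scale1r derive_linear// mul1r.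
  rewrite (derive_horiz_sum oO (sg i) Uc) (derive_vert_sum oO (sg i) Uc) -big_split/=.
  apply: le_trans (ler_norm_sum _ _ _) _.
  apply: (@le_trans _ _ ((\sum_k (`|'D_(horiz (e k)) (g i) z| + `|'D_(vert (e k)) (g i) z|)) * `|w|)).
    rewrite mulr_suml; apply: ler_sum => k _.
    rewrite mulrDl; apply: le_trans (ler_normD _ _) _.
    apply: lerD; rewrite normrM mulrC; apply: ler_wpM2l => //.
      by apply: le_trans (coord_le_norm _ _) _; rewrite prod_normE le_max lexx.
    by apply: le_trans (coord_le_norm _ _) _; rewrite prod_normE le_max lexx orbT.
  apply: ler_wpM2r => //; rewrite /S (bigD1 i)//= lerDl.
  by apply: sumr_ge0 => j _; apply: sumr_ge0 => k _; rewrite addr_ge0.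
apply: le_trans (bound _) _; apply: ler_wpM2r => //.
rewrite -lerBlDl; apply: le_trans Sc; rewrite distrC; exact: ler_norm.
Qed.

Lemma is_derive_coord (V : normedModType R) m (z : V -> 'rV[R]_m) (t v : V) w i :
  is_derive t v z w -> is_derive t v (fun s => z s 0 i) (w 0 i).
Proof.
move=> [dz <-]; apply: DeriveDef; first exact: ((derivable_mxP _ _ _).1 dz).
by rewrite derive_mx// mxE.
Qed.

Lemma proportional_derive (a b : R -> R) (A B C t a' b' : R) :
  (\forall s \near t, A * a s - B * b s = C) ->
  is_derive t 1 a a' -> is_derive t 1 b b' -> A * a' = B * b'.
Proof.
move=> N Da Db.
have H := is_deriveB (is_deriveZ A Da) (is_deriveZ B Db).
have [_ E1] := near_eq_is_derive N H.
have [_ E2] := is_derive_cst C t 1.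
by apply/eqP; rewrite -subr_eq0 -[X in X == _]E1 E2.
Qed.

End LocalLipschitz.

Lemma proportional_solve (R : realFieldType) (vi vj yi yj Gi Gj : R) :
  vi != 0 -> yi != 0 -> vi * yj = vj * yi -> vi * (-2 * Gj) = vj * (-2 * Gi) ->
  Gj = Gi / yi * yj.
Proof.
move=> v0 y0 H1 H2.
have H3 : vi * Gj = vj * Gi by lra.
apply: (mulfI v0); rewrite H3.
have -> : vi * (Gi / yi * yj) = Gi / yi * (vi * yj) by ring.
by rewrite H1; field.
Qed.

Section Geodesics.
Context {R : realType} {n : nat}.
Local Notation vec := 'rV[R]_n.
Local Notation e i := (delta_mx 0 i : vec).

(** Position and velocity are concatenated for the first-order system. Splitting does not increase
    the norm, so balls and Lipschitz bounds transfer. *)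
Let P (z : 'rV[R]_(n + n)) : vec * vec := (lsubmx z, rsubmx z).

Let P_norm a b : `|P a - P b| <= `|a - b|.
Proof.
rewrite prod_normE ge_max; apply/andP; split; apply: row_norm_le => // i.
  have -> : (P a - P b).1 0 i = (a - b) 0 (lshift n i) by rewrite /= !mxE.
  exact: coord_le_norm.
have -> : (P a - P b).2 0 i = (a - b) 0 (rshift n i) by rewrite /= !mxE.
exact: coord_le_norm.
Qed.

Lemma second_order_ode (g : vec -> vec -> vec) (x0 y0 : vec) (r L : R) :
  0 < r -> 0 <= L ->
  (forall a b, ball (x0, y0) r a -> ball (x0, y0) r b ->
    `|g a.1 a.2 - g b.1 b.2| <= L * `|a - b|) ->
  exists2 d : R, 0 < d & exists gam eta : R -> vec,
  [/\ gam 0 = x0, eta 0 = y0, forall t, ball (x0, y0) r (gam t, eta t) &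
    forall t : R, `|t| < d -> is_derive t 1 gam (eta t) /\
      is_derive t 1 eta (g (gam t) (eta t))].
Proof.
move=> r0 L0 glip.
pose Vf (z : 'rV[R]_(n + n)) : 'rV[R]_(n + n) :=
  row_mx (rsubmx z) (g (lsubmx z) (rsubmx z)).
pose z0 : 'rV[R]_(n + n) := row_mx x0 y0.
have Pz0 : P z0 = (x0, y0) by rewrite /P row_mxKl row_mxKr.
have Pball a : `|a - z0| < r -> ball (x0, y0) r (P a).
  move=> az; rewrite -ball_normE/= -Pz0 distrC; exact: le_lt_trans (P_norm _ _) az.
(* The velocity half contributes the constant 1 and the acceleration half contributes [L]. *)
have Vlip a b : `|a - z0| < r -> `|b - z0| < r -> `|Vf a - Vf b| <= (1 + L) * `|a - b|.
  move=> /Pball az /Pball bz.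
  have H1 : `|rsubmx a - rsubmx b| <= `|a - b|.
    by apply: le_trans (P_norm a b); rewrite prod_normE le_max lexx orbT.
  have H2 : `|g (lsubmx a) (rsubmx a) - g (lsubmx b) (rsubmx b)| <= L * `|a - b|.
    by apply: le_trans (glip _ _ az bz) _; rewrite ler_wpM2l.
  apply: row_norm_le => [|i]; first by rewrite mulr_ge0// addr_ge0.
  rewrite mulrDl mul1r mxE [X in _ + X]mxE; case: (split_ordP i) => j ->.
    rewrite !row_mxEl; apply: (@le_trans _ _ `|a - b|); last by rewrite lerDl mulr_ge0.
    by apply: le_trans H1; have := coord_le_norm (rsubmx a - rsubmx b) j; rewrite !mxE.
  rewrite !row_mxEr; apply: (@le_trans _ _ (L * `|a - b|)); last by rewrite lerDr.
  by apply: le_trans H2; have := coord_le_norm (g (lsubmx a) (rsubmx a) -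
    g (lsubmx b) (rsubmx b)) j; rewrite !mxE.
have [|d d0 [z [zz0 zr dz]]] := Picard_Lindelof r0 _ Vlip; first by rewrite addr_ge0.
exists d => //; exists (fun t => lsubmx (z t)), (fun t => rsubmx (z t)); split.
- by rewrite zz0 row_mxKl.
- by rewrite zz0 row_mxKr.
- by move=> t; exact: Pball (zr t).
move=> t td; have Dz i := is_derive_coord i (dz t td).
split.
  have -> : (fun s => lsubmx (z s)) = fun s => \row_i z s 0 (lshift n i).
    by apply/funext => s; apply/rowP => i; rewrite !mxE.
  have -> : rsubmx (z t) = \row_i Vf (z t) 0 (lshift n i).
    by apply/rowP => i; rewrite [RHS]mxE row_mxEl.
  by apply: is_derive_row => i; exact: Dz.
have -> : (fun s => rsubmx (z s)) = fun s => \row_i z s 0 (rshift n i).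
  by apply/funext => s; apply/rowP => i; rewrite !mxE.
have -> : g (lsubmx (z t)) (rsubmx (z t)) = \row_i Vf (z t) 0 (rshift n i).
  by apply/rowP => i; rewrite [RHS]mxE row_mxEr.
by apply: is_derive_row => i; exact: Dz.
Qed.

Variables (Omega : set vec) (F : vec -> vec -> R).
Hypotheses (oO : open Omega) (HF : finsler_metric Omega F).
Local Notation f := (unc F).
Local Notation Q := (unc (sqF F)).
Local Notation U := (slit Omega).

Lemma near_norm_lt (t d : R) : `|t| < d -> \forall s \near t, `|s| < d.
Proof. by move=> td; exact: (@cvgr_norm_lt _ _ _ _ _ id t cvg_id d td). Qed.

(** By [spray_energy] the squared norm has zero derivative along a solution. This supplies the
    constant speed demanded by [geodesic]. *)
Lemma const_speed (gam eta : R -> vec) (d : R) :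
  (forall t, U (gam t, eta t)) ->
  (forall t : R, `|t| < d -> is_derive t 1 gam (eta t) /\
      is_derive t 1 eta (-2 *: spray_vec F (gam t) (eta t))) ->
  forall t : R, `|t| < d -> F (gam t) (eta t) = F (gam 0) (eta 0).
Proof.
move=> HU HD.
pose q t := Q (gam t, eta t).
have dq (t : R) : `|t| < d -> is_derive t 1 q 0.
  move=> td; have [D1 D2] := HD t td.
  have dQ : differentiable Q (gam t, eta t).
    by apply: (smooth_differentiable oO (Q_smooth oO HF)).
  have := is_derive_curve dQ (is_derive_pair D1 D2).
  have [Ot e0] := HU t.
  have -> : (eta t, -2 *: spray_vec F (gam t) (eta t)) =
      -2 *: vert (spray_vec F (gam t) (eta t)) + horiz (eta t).
    have := vertD (-2) (spray_vec F (gam t) (eta t)) 0; rewrite addr0 => EV.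
    by rewrite [LHS]pair_horiz_vert /= EV addrC; congr (_ + _); exact: addr0.
  rewrite derive_linear// -(spray_energy oO HF Ot e0).
  by rewrite mulNr addNr.
have E (y : R) : (0 : R) + y *: (1 : R) = y by rewrite add0r [_ *: _]mulr1.
move=> t td.
have Nt (s : R) : 0 <= s <= 1 -> `|s * t| < d.
  move=> /andP[s0 s1]; rewrite normrM (ger0_norm s0).
  by apply: le_lt_trans td; rewrite ler_piMl.
have [s|c] := @MVT_line _ _ q 0 1 t.
  by move=> /Nt s01; rewrite E; have [] := dq _ s01.
move=> /Nt c01; rewrite !E; have [_ ->] := dq _ c01; rewrite mulr0 => /eqP.
have [Ot e0] := HU t; have [Og e00] := HU 0.
rewrite subr_eq0 /q !uncE => /eqP Eq.
have {}Eq : F (gam t) (eta t) ^+ 2 = F (gam 0) (eta 0) ^+ 2 by exact: Eq.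
by apply/eqP; rewrite -(@eqrXn2 _ 2)//; [rewrite Eq|exact: (F_ge0 HF)|exact: (F_ge0 HF)].
Qed.

(* The geodesic with initial velocity y0 stays on a line, so its acceleration
   -2 G(x0, y0) is parallel to its velocity. *)
Lemma flat_radial x0 y0 : projectively_flat Omega F -> Omega x0 -> y0 != 0 ->
  exists l : R, spray_vec F x0 y0 = l *: y0.
Proof.
move=> flat Ox0 y00.
have [r r0 [L L0 [brU lip]]] := @local_lipschitz _ _ _ _
  (fun i => unc (spray_coef F i)) (x0, y0) oO (smooth_spray oO HF) (slitP Ox0 y00).
have glip a b : ball (x0, y0) r a -> ball (x0, y0) r b ->
    `|(-2 *: spray_vec F a.1 a.2) - (-2 *: spray_vec F b.1 b.2)| <= (2 * L) * `|a - b|.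
  move=> ar br; rewrite -scalerBr normrZ normrN ger0_norm// -mulrA ler_wpM2l//.
  apply: row_norm_le => [|i]; first by rewrite mulr_ge0.
  by rewrite !mxE; have := lip i a b ar br; case: a ar => a1 a2 _; case: b br => b1 b2 _.
have [|d d0 [gam [eta [g0 e0 ballt D]]]] :=
    @second_order_ode (fun x y => -2 *: spray_vec F x y) _ _ _ _ r0 _ glip.
  by rewrite mulr_ge0.
have HU t : U (gam t, eta t) by exact/brU/ballt.
have speed := const_speed HU D.
have I_near (t : R) : `]- d, d[%classic t -> \forall s \near t, `|s| < d.
  by rewrite /= in_itv/= -ltr_norml; exact: near_norm_lt.
have It (t : R) : `]- d, d[%classic t -> `|t| < d.
  by rewrite /= in_itv/= -ltr_norml.
have d1 (t : R) : `|t| < d -> derive1 gam t = eta t.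
  by move=> /D[[_ <-] _]; rewrite derive1E.
have d1n (t : R) : `|t| < d -> \forall s \near t, eta s = derive1 gam s.
  by move=> /near_norm_lt; apply: filterS => s /d1.
have D2 (t : R) : `|t| < d ->
    is_derive t 1 (derive1 gam) (-2 *: spray_vec F (gam t) (eta t)).
  by move=> td; apply: near_eq_is_derive (d1n t td) _; have [] := D t td.
have Fpos : 0 < F (gam 0) (eta 0).
  by have [Og e1] := HU 0; exact: (F_gt0 HF).
have geo : geodesic Omega F `]- d, d[%classic gam.
  split.
  - by split; [exact: itv_open|exact: interval_is_interval].
  - by move=> t _; have [] := HU t.
  - by exists (F (gam 0) (eta 0)) => // t /It td; rewrite d1// speed.
  - move=> t /It td; split; first by have [[]] := D t td.
    by have [] := D2 t td.
  - move=> t /It td i; have [_ E] := D2 t td.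
    by rewrite derive1E E d1// !mxE mulNr addNr.
have [p [v [v0 line]]] := flat _ _ geo.
have In (t : R) : `|t| < d -> exists s : R, gam t = p + s *: v.
  by move=> td; apply: line; rewrite /= in_itv/= -ltr_norml.
have [i vi] : exists i, v 0 i != 0.
  apply/existsP; apply: contraR v0; rewrite negb_exists => /forallP H.
  by apply/eqP/rowP => i; rewrite mxE; apply/eqP; have := H i; rewrite negbK.
(* The parameter along the line comes without any regularity. Eliminating it between coordinates [i]
   and [j] leaves an affine relation that can be differentiated. *)
have prop1 j (t : R) : `|t| < d -> v 0 i * eta t 0 j = v 0 j * eta t 0 i.
  move=> td; have [D1 _] := D t td.
  apply: proportional_derive (is_derive_coord j D1) (is_derive_coord i D1).
  apply: (_ : \forall s \near t, _ = v 0 i * p 0 j - v 0 j * p 0 i).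
  by apply: filterS (near_norm_lt td) => s /In[c ->]; rewrite !mxE; ring.
have z0d : `|0 : R| < d by rewrite normr0.
have prop2 j : v 0 i * (-2 *: spray_vec F (gam 0) (eta 0)) 0 j =
    v 0 j * (-2 *: spray_vec F (gam 0) (eta 0)) 0 i.
  have [_ D2'] := D 0 z0d.
  apply: proportional_derive (is_derive_coord j D2') (is_derive_coord i D2').
  apply: (_ : \forall s \near _, _ = 0).
  by apply: filterS (near_norm_lt z0d) => s /(prop1 j) ->; rewrite subrr.
rewrite g0 e0 in prop2; have {}prop1 j := prop1 j 0 z0d; rewrite e0 in prop1.
have yi : y0 0 i != 0.
  apply: contraNneq y00 => yi; apply/eqP/rowP => j; rewrite mxE.
  by apply: (mulfI vi); rewrite prop1 yi !mulr0.
set G := spray_vec F x0 y0 in prop2 *.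
exists (G 0 i / y0 0 i); apply/rowP => j; rewrite [RHS]mxE.
apply: proportional_solve vi yi (prop1 j) _.
have sE k : (-2 *: G) 0 k = -2 * G 0 k by rewrite [LHS]mxE.
by have := prop2 j; rewrite !sE.
Qed.

End Geodesics.

(** * Flag curvature *)

Lemma curvature_quotient (R : fieldType) (a b c : R) : b != 0 -> c != 0 ->
  a = a * b / (c ^+ 2 * b) * c ^+ 2.
Proof. by move=> b0 c0; field; rewrite b0 c0. Qed.

Section Curvature.
Context {R : realType} {n : nat}.
Local Notation vec := 'rV[R]_n.
Local Notation e i := (delta_mx 0 i : vec).

Lemma sum_mul_delta (G : 'I_n -> R) i : \sum_j G j * (i == j)%:R = G i.
Proof.
rewrite (bigD1 i)//= eqxx mulr1 big1 ?addr0// => j ji.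
by rewrite eq_sym (negbTE ji) mulr0.
Qed.

(** The Riemann tensor of the spray with coefficients [P y^i]. Here [a] and [p] are the derivatives
    of [P] in position and velocity, [B] the mixed and [C] the vertical second derivatives; the
    hypotheses are Euler's identities for [P] and for its vertical derivatives. *)
Lemma radial_curvature_identity (y a p : 'I_n -> R) (B C : 'I_n -> 'I_n -> R) (P : R) i k :
  \sum_j y j * p j = P -> (forall k, \sum_j y j * C j k = 0) ->
  2 * (a k * y i) - (\sum_j y j * (B j k * y i + a j * (i == k)%:R))
  + 2 * (\sum_j P * y j * (C j k * y i + p j * (i == k)%:R + p k * (i == j)%:R))
  - \sum_j (p j * y i + P * (i == j)%:R) * (p k * y j + P * (j == k)%:R) =
  (P ^+ 2 - \sum_j y j * a j) * (i == k)%:R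
  + (2 * a k - (\sum_j y j * B j k) - P * p k) * y i.
Proof.
move=> HP HC.
have E1 : \sum_j y j * (B j k * y i + a j * (i == k)%:R) =
    (\sum_j y j * B j k) * y i + (\sum_j y j * a j) * (i == k)%:R.
  by rewrite !mulr_suml -big_split; apply: eq_bigr => j _ /=; ring.
have E2 : \sum_j P * y j * (C j k * y i + p j * (i == k)%:R + p k * (i == j)%:R) =
    P * P * (i == k)%:R + P * p k * y i.
  transitivity (P * y i * (\sum_j y j * C j k) + P * (i == k)%:R * (\sum_j y j * p j)
    + P * p k * (\sum_j y j * (i == j)%:R)).
    by rewrite !mulr_sumr -!big_split; apply: eq_bigr => j _ /=; ring.
  by rewrite HC HP sum_mul_delta; ring.
have E3 : \sum_j (p j * y i + P * (i == j)%:R) * (p k * y j + P * (j == k)%:R) =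
    3 * P * p k * y i + P ^+ 2 * (i == k)%:R.
  transitivity (y i * p k * (\sum_j y j * p j) + y i * P * (\sum_j p j * (k == j)%:R)
    + P * p k * (\sum_j y j * (i == j)%:R) + P ^+ 2 * (\sum_j (j == k)%:R * (i == j)%:R)).
    rewrite !mulr_sumr -!big_split; apply: eq_bigr => j _ /=.
    by rewrite (eq_sym k j); ring.
  by rewrite HP !sum_mul_delta; ring.
rewrite E1 E2 E3; ring.
Qed.

Variables (Omega : set vec) (F : vec -> vec -> R).
Hypotheses (oO : open Omega) (HF : finsler_metric Omega F).
Local Notation f := (unc F).
Local Notation U := (slit Omega).
Local Notation Fs := (F_smooth HF).
Let oU := open_slit oO.

(** The projective factor on pairs, expanded in sums and products so that the closure properties of
    [Ck] apply directly. *)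
Definition pfac (z : vec * vec) : R := (\sum_k z.2 0 k * 'D_(horiz (e k)) f z) * (2 * f z)^-1.

Lemma pfacE x y : pfac (x, y) = projective_factor F x y.
Proof.
rewrite /pfac /projective_factor uncE; congr (_ / _).
by apply: eq_bigr => k _; rewrite dx_unc.
Qed.

Lemma smooth_pfac : smooth U pfac.
Proof.
move=> m; apply: CkM => //.
  apply: Ck_sum => // k _; apply: CkM => //; first exact: smooth_coord2.
  by apply: smooth_derive; exact: Fs.
apply: CkV => //.
  case=> x y [Ox y0]; rewrite uncE mulf_neq0 ?gt_eqF//; exact: (F_gt0 HF).
by apply: CkM => //; [exact: Ck_cst|exact: Fs].
Qed.

Lemma homog_pfac : homog Omega 1 pfac.
Proof.
move=> x y a Ox y0 a0; rewrite /pfac !uncE.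
have Fa : F x (a *: y) = a * F x y by rewrite (F_scale0 HF)// ltW.
have h k : 'D_(horiz (e k)) f (x, a *: y) = a * 'D_(horiz (e k)) f (x, y).
  by rewrite (homog_horiz oO (e k) Fs (F_homog HF))// expr1.
have -> : \sum_k (x, a *: y).2 0 k * 'D_(horiz (e k)) f (x, a *: y) =
    a * a * \sum_k (x, y).2 0 k * 'D_(horiz (e k)) f (x, y).
  by rewrite mulr_sumr; apply: eq_bigr => k _; rewrite h /= mxE; ring.
rewrite Fa expr1; have Fxy := F_gt0 HF Ox y0.
have Fn : F x y != 0 by rewrite gt_eqF.
have an : a != 0 by rewrite gt_eqF.
move: (\sum_k _) (F x y) Fn => s b bn {Fa h Fxy}; field.
by rewrite an bn.
Qed.

Hypothesis radial : forall x y, Omega x -> y != 0 ->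
  exists l : R, spray_vec F x y = l *: y.

Lemma spray_pfac z i : U z -> unc (spray_coef F i) z = pfac z * z.2 0 i.
Proof.
case: z => x y [Ox y0]; rewrite uncE pfacE.
have := spray_projective oO HF radial Ox y0.
by move=> /rowP/(_ i); rewrite !mxE.
Qed.

Lemma derive_mul_coord (h : vec * vec -> R) z w i : derivable h z w ->
  'D_w (fun z : vec * vec => h z * z.2 0 i) z = 'D_w h z * z.2 0 i + h z * w.2 0 i.
Proof.
move=> dh; have [_ E] := is_deriveM (derivableP dh) (is_derive_coord2 z w i).
by rewrite [LHS]E /GRing.scale/= addrC (mulrC (z.2 0 i)).
Qed.

Lemma derive_spray z w i : U z -> 'D_w (unc (spray_coef F i)) z =
  'D_w pfac z * z.2 0 i + pfac z * w.2 0 i.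
Proof.
move=> Uz; rewrite -derive_mul_coord; last exact: smooth_derivable smooth_pfac Uz.
by apply: (derive_ext_on _ oU) Uz => z' /spray_pfac.
Qed.

Lemma derive2_spray z w w' i : U z -> 'D_w' ('D_w (unc (spray_coef F i))) z =
  'D_w' ('D_w pfac) z * z.2 0 i + 'D_w pfac z * w'.2 0 i + 'D_w' pfac z * w.2 0 i.
Proof.
move=> Uz.
have d1 := smooth_derivable (v := w') (smooth_derive w smooth_pfac) Uz.
have d0 := smooth_derivable (v := w') smooth_pfac Uz.
have [dc _] := is_derive_coord2 z w' i.
have D1 := is_deriveM (derivableP d1) (is_derive_coord2 z w' i).
have D2 := is_deriveM (derivableP d0) (is_derive_cst (w.2 0 i) z w').
have [_ E] := is_deriveD D1 D2.
transitivity ('D_w' (fun z : vec * vec => 'D_w pfac z * z.2 0 i + pfac z * w.2 0 i) z).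
  by apply: (derive_ext_on _ oU) Uz => z' Uz'; exact: derive_spray.
rewrite [LHS]E /GRing.scale/= mulr0 add0r.
by rewrite addrC [X in X + _]mulrC [X in _ + X]addrC (mulrC (z.2 0 i)) addrC.
Qed.

Lemma delta_coord k i : (e k) 0 i = (i == k)%:R.
Proof. by rewrite mxE eqxx. Qed.

Lemma riemann_radial x y i k : Omega x -> y != 0 ->
  riemann_curvature F x y i k =
  (pfac (x, y) ^+ 2 - 'D_(horiz y) pfac (x, y)) * (i == k)%:R
  + (2 * 'D_(horiz (e k)) pfac (x, y)
     - (\sum_j y 0 j * 'D_(vert (e k)) ('D_(horiz (e j)) pfac) (x, y))
     - pfac (x, y) * 'D_(vert (e k)) pfac (x, y)) * y 0 i.
Proof.
move=> Ox y0; have Uz := slitP Ox y0.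
rewrite (derive_horiz_sum oO smooth_pfac Uz).
rewrite -(@radial_curvature_identity (y 0) (fun k => 'D_(horiz (e k)) pfac (x, y))
  (fun k => 'D_(vert (e k)) pfac (x, y))
  (fun j k => 'D_(vert (e k)) ('D_(horiz (e j)) pfac) (x, y))
  (fun j k => 'D_(vert (e k)) ('D_(vert (e j)) pfac) (x, y))); last 2 first.
- rewrite -(derive_vert_sum oO smooth_pfac Uz) (Euler smooth_pfac homog_pfac Ox y0).
  by rewrite mul1r.
- move=> m; rewrite -(derive2_vert_sum oO smooth_pfac Uz).
  rewrite (Schwarz (vert (e m)) (vert y) oU smooth_pfac Uz).
  rewrite (Euler (smooth_derive _ smooth_pfac)
    (homog_vert oO (e m) smooth_pfac homog_pfac) Ox y0).
  by rewrite mul0r.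
have hz (v : vec) : (horiz v).2 = 0 by [].
have D1 j : dy j (spray_coef F i) x y =
    'D_(vert (e j)) pfac (x, y) * y 0 i + pfac (x, y) * (i == j)%:R.
  by rewrite dy_unc derive_spray// vert2 delta_coord.
have D1' j : dy k (spray_coef F j) x y =
    'D_(vert (e k)) pfac (x, y) * y 0 j + pfac (x, y) * (j == k)%:R.
  by rewrite dy_unc derive_spray// vert2 delta_coord.
have Dx : dx k (spray_coef F i) x y = 'D_(horiz (e k)) pfac (x, y) * y 0 i.
  by rewrite dx_unc derive_spray// hz mxE mulr0 addr0.
have D2x j : dy k (dx j (spray_coef F i)) x y =
    'D_(vert (e k)) ('D_(horiz (e j)) pfac) (x, y) * y 0 i
    + 'D_(horiz (e j)) pfac (x, y) * (i == k)%:R.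
  by rewrite dy_dx_unc derive2_spray// vert2 hz delta_coord mxE mulr0 addr0.
have D2y j : dy k (dy j (spray_coef F i)) x y =
    'D_(vert (e k)) ('D_(vert (e j)) pfac) (x, y) * y 0 i
    + 'D_(vert (e j)) pfac (x, y) * (i == k)%:R
    + 'D_(vert (e k)) pfac (x, y) * (i == j)%:R.
  by rewrite dy_dy_unc derive2_spray// !vert2 !delta_coord.
have Gj j : spray_coef F j x y = pfac (x, y) * y 0 j.
  by rewrite -uncE spray_pfac.
have S1 := eq_bigr (op := +%R) (idx := 0) (r := index_enum 'I_n) (P := xpredT) _
  (fun j _ => congr1 ( *%R (y 0 j)) (D2x j)).
have S2 := eq_bigr (op := +%R) (idx := 0) (r := index_enum 'I_n) (P := xpredT) _
  (fun j _ => f_equal2 *%R (Gj j) (D2y j)).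
have S3 := eq_bigr (op := +%R) (idx := 0) (r := index_enum 'I_n) (P := xpredT) _
  (fun j _ => f_equal2 *%R (D1 j) (D1' j)).
rewrite mxE; exact: (f_equal2 (fun a b => a - b)
  (f_equal2 +%R (f_equal2 (fun a b => 2 * a - b) Dx S1) (congr1 ( *%R 2) S2)) S3).
Qed.

Lemma innerDl x y (a : R) u v w :
  inner F x y (a *: u + v) w = a * inner F x y u w + inner F x y v w.
Proof. by rewrite /inner !mulmxDl -!scalemxAl !mxE. Qed.

Lemma innerDr x y (a : R) u v w :
  inner F x y w (a *: u + v) = a * inner F x y w u + inner F x y w v.
Proof. by rewrite /inner linearP/= mulmxDr -scalemxAr !mxE. Qed.

(** One Gram-Schmidt step on a basis vector [e k], with [k] different from an index [i] where [y] is
    nonzero; two distinct indices exist as [2 <= n]. Coordinates [i] and [k] then show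
    independence. *)
Lemma orthogonal_vector x y : (2 <= n)%N -> Omega x -> y != 0 ->
  exists u : vec, row_free (col_mx y u) /\ inner F x y y u = 0.
Proof.
move=> n2 Ox y0.
have [i yi] : exists i, y 0 i != 0.
  apply/existsP; apply: contraR y0; rewrite negb_exists => /forallP H.
  by apply/eqP/rowP => i; rewrite mxE; apply/eqP; have := H i; rewrite negbK.
have [k ki] : exists k : 'I_n, k != i.
  have : (1 < #|'I_n|)%N by rewrite card_ord.
  move=> /card_gt1P[a [b [_ _ ab]]].
  by have [ai|] := eqVneq a i; [exists b; rewrite -ai eq_sym|exists a].
pose c := inner F x y y (e k) / inner F x y y y.
have yy := inner_gt0 oO HF Ox y0 y0.
exists (- c *: y + e k); split; last first.
  by rewrite innerDr /c mulNr divfK ?gt_eqF// addNr.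
apply: inj_row_free => w; rewrite -[w]hsubmxK mul_row_col.
rewrite [lsubmx w]mx11_scalar [rsubmx w]mx11_scalar !mul_scalar_mx.
move: (lsubmx w 0 0) (rsubmx w 0 0) => a b E.
have Ei : a = b * c.
  have /rowP/(_ i) := E; rewrite !mxE (eq_sym i k) (negbTE ki) andbF addr0.
  move=> H; apply: (mulIf yi); apply/eqP; rewrite -subr_eq0 -H; apply/eqP; ring.
have b0 : b = 0.
  have /rowP/(_ k) := E; rewrite !mxE !eqxx/= Ei => <-; ring.
by rewrite Ei b0 mul0r !raddf0 row_mx0.
Qed.

(* For a transverse edge u orthogonal to y, the term of the Riemann tensor
   proportional to y drops out and only the multiple of the identity remains. *)
Lemma flag_curvature_pfac (K : R) x y : (2 <= n)%N ->
  constant_flag_curvature Omega F K -> Omega x -> y != 0 ->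
  pfac (x, y) ^+ 2 - 'D_(horiz y) pfac (x, y) = K * F x y ^+ 2.
Proof.
move=> n2 HK Ox y0; have [u [fu yu]] := orthogonal_vector n2 Ox y0.
have u0 : u != 0.
  apply: contraTneq fu => ->; rewrite /row_free.
  have -> : \rank (col_mx y (0 : vec)) = \rank y.
    by rewrite -addsmxE addsmx0.
  by rewrite neq_ltn (leq_ltn_trans (rank_leq_row y)).
have uu := inner_gt0 oO HF Ox y0 u0.
have yy : inner F x y y y = F x y ^+ 2.
  rewrite (innerE oO HF y y Ox y0) (vert_Euler2 oO HF y Ox y0).
  by rewrite (Euler (Q_smooth oO HF) (Q_homog HF) Ox y0) mulrA mulVf// mul1r.
have := HK x y u Ox fu; rewrite /flag_curvature yu yy expr0n subr0.
set Xi := _ - _.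
pose tau := \sum_k u 0 k * (2 * 'D_(horiz (e k)) pfac (x, y)
     - (\sum_j y 0 j * 'D_(vert (e k)) ('D_(horiz (e j)) pfac) (x, y))
     - pfac (x, y) * 'D_(vert (e k)) pfac (x, y)).
have -> : u *m (riemann_curvature F x y)^T = tau *: y + Xi *: u.
  apply/rowP => i; rewrite [LHS]mxE !mxE /tau mulr_suml.
  have -> : Xi * u 0 i = \sum_k u 0 k * (i == k)%:R * Xi.
    by rewrite -mulr_suml sum_mul_delta mulrC.
  rewrite -big_split; apply: eq_bigr => k _.
  rewrite [X in _ * X]mxE riemann_radial// -/Xi /=.
  rewrite mulrDr addrC; congr (_ + _); first by rewrite mulrCA mulrC.
  by move: (2 * _ - _ - _) => T; rewrite mulrA.
rewrite innerDl yu mulr0 add0r -[Xi *: u]addr0 innerDl.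
have -> : inner F x y 0 u = 0 by rewrite /inner !mul0mx mxE.
have Fxy := F_gt0 HF Ox y0.
rewrite addr0 => <-; apply: curvature_quotient; rewrite gt_eqF//.
Qed.

End Curvature.

(** * The Riccati equation along a line *)

Section Riccati.
Context {R : realType}.
Implicit Types (f p : R -> R) (t : R).

Lemma eq_of_derive0 (g : R -> R) :
  (forall t, 0 <= t <= 1 -> is_derive t 1 g 0) -> forall t, 0 <= t <= 1 -> g t = g 0.
Proof.
move=> dg t t01.
have s01 s : 0 <= s <= t -> 0 <= s <= 1.
  by case/andP: t01 => _ t1 /andP[-> st]; exact: le_trans st t1.
have /andP[t0 t1] := t01.
have [s|s|c _] := @MVT_segment _ g (fun=> 0) 0 t t0.
- by rewrite in_itv/= => /andP[/ltW a /ltW b]; apply: dg; apply: s01; rewrite a.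
- apply: derivable_within_continuous => r; rewrite in_itv/= => r0.
  by have [] := dg r (s01 r r0).
- by rewrite mul0r => /eqP; rewrite subr_eq0 => /eqP.
Qed.

Lemma is_derive_inv f (df t : R) : f t != 0 -> is_derive t 1 f df ->
  is_derive t 1 (fun s => (f s)^-1) (- df / f t ^+ 2).
Proof.
move=> f0 [d <-].
apply: DeriveDef; first exact: derivableV.
rewrite [LHS](deriveV f0 d) /GRing.scale/= mulrC mulNr mulrN.
by [].
Qed.

Lemma is_derive_mul f g (df dg t : R) : is_derive t 1 f df -> is_derive t 1 g dg ->
  is_derive t 1 (fun s => f s * g s) (f t * dg + g t * df).
Proof. by move=> Df Dg; exact: is_deriveM. Qed.

Lemma is_derive_cmul a f (df t : R) : is_derive t 1 f df ->
  is_derive t 1 (fun s => a * f s) (a * df).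
Proof. by move=> Df; exact: is_deriveZ. Qed.

Lemma is_derive_add f g (df dg t : R) : is_derive t 1 f df -> is_derive t 1 g dg ->
  is_derive t 1 (fun s => f s + g s) (df + dg).
Proof. by move=> Df Dg; exact: is_deriveD. Qed.

Lemma is_derive_sub f g (df dg t : R) : is_derive t 1 f df -> is_derive t 1 g dg ->
  is_derive t 1 (fun s => f s - g s) (df - dg).
Proof. by move=> Df Dg; exact: is_deriveB. Qed.

Lemma is_derive_lin1 (a b t : R) : is_derive t 1 (fun s : R => a + b * s) b.
Proof.
have H := is_deriveD (is_derive_cst a t 1) (is_deriveZ b (is_derive_id t 1)).
by apply: is_derive_eq; rewrite add0r [_ *: 1]mulr1.
Qed.

(** If [1 - c * t] were at most 0 for some [t] in the interval, then [c >= 1] and [c^-1] would be a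
    zero in it. *)
Lemma linear_pos (c : R) : (forall t, 0 <= t <= 1 -> 1 - c * t != 0) ->
  forall t, 0 <= t <= 1 -> 0 < 1 - c * t.
Proof.
move=> H t /andP[t0 t1]; rewrite ltNge; apply/negP => ct.
have ct1 : 1 <= c * t by move: ct; lra.
have c1 : 1 <= c.
  have c0 : 0 < c.
    by rewrite ltNge; apply/negP => c0; have := mulr_le0_ge0 c0 t0; move: ct1; lra.
  by apply: le_trans ct1 _; rewrite ger_pMr.
have c0 : 0 < c by apply: lt_le_trans c1.
have c01 : 0 <= c^-1 <= 1 by rewrite invr_ge0 ltW//= invf_le1.
by have := H _ c01; rewrite mulfV ?(lt0r_neq0 c0)// subrr eqxx.
Qed.

Variables (f p : R -> R) (K : R).
Hypothesis f_gt0 : forall t, 0 <= t <= 1 -> 0 < f t.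
Hypothesis f_der : forall t, 0 <= t <= 1 -> is_derive t 1 f (2 * p t * f t).
Hypothesis p_der : forall t, 0 <= t <= 1 -> is_derive t 1 p (p t ^+ 2 - K * f t ^+ 2).

Let i00 : (0 : R) <= (0 : R) <= (1 : R). Proof. by rewrite lexx ler01. Qed.

Let dinv t : 0 <= t <= 1 -> is_derive t 1 (fun s => (f s)^-1) (- 2 * p t * (f t)^-1).
Proof.
move=> t01; have f0 := lt0r_neq0 (f_gt0 t01).
have H := is_derive_inv f0 (f_der t01).
by apply: is_derive_eq; field.
Qed.

(* 1/f is a quadratic polynomial: (1/f)' = -2p/f, (p/f)' = -(p^2 + K f^2)/f and
   (p^2 + K f^2)/f is constant. *)
Lemma Riccati_inverse t : 0 <= t <= 1 ->
  f 0 * (f t)^-1 = (1 - p 0 * t) ^+ 2 + K * (f 0 * t) ^+ 2.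
Proof.
move=> t01.
pose c := (p 0 ^+ 2 + K * f 0 ^+ 2) * (f 0)^-1.
have f00 := lt0r_neq0 (f_gt0 i00).
have H1 s : 0 <= s <= 1 -> (p s * p s + K * (f s * f s)) * (f s)^-1 = c.
  move=> s01; rewrite /c !expr2.
  apply: (@eq_of_derive0 (fun s => (p s * p s + K * (f s * f s)) * (f s)^-1)) s01 => r r01.
  have f0 := lt0r_neq0 (f_gt0 r01).
  have Dp := p_der r01; have Df := f_der r01.
  have H := is_derive_mul (is_derive_add (is_derive_mul Dp Dp)
    (is_derive_cmul K (is_derive_mul Df Df))) (dinv r01).
  by apply: is_derive_eq; field.
have H2 s : 0 <= s <= 1 -> p s * (f s)^-1 + c * s = p 0 * (f 0)^-1.
  move=> s01; transitivity (p 0 * (f 0)^-1 + c * 0); last by rewrite mulr0 addr0.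
  apply: (@eq_of_derive0 (fun s => p s * (f s)^-1 + c * s) _ s s01) => r r01.
  have f0 := lt0r_neq0 (f_gt0 r01).
  have H := is_derive_add (is_derive_mul (p_der r01) (dinv r01))
    (is_derive_cmul c (is_derive_id r 1)).
  by apply: is_derive_eq; rewrite mulr1 -(H1 r r01); field.
have H3 : (f t)^-1 - (f 0)^-1 + 2 * (p 0 * (f 0)^-1) * t - c * (t * t) = 0.
  transitivity ((f 0)^-1 - (f 0)^-1 + 2 * (p 0 * (f 0)^-1) * 0 - c * (0 * 0)); last by ring.
  apply: (@eq_of_derive0 (fun s => (f s)^-1 - (f 0)^-1
    + 2 * (p 0 * (f 0)^-1) * s - c * (s * s)) _ t t01) => r r01.
  have f0 := lt0r_neq0 (f_gt0 r01).
  have H := is_derive_sub (is_derive_add (is_derive_sub (dinv r01) (is_derive_cst (f 0)^-1 r 1))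
    (is_derive_cmul (2 * (p 0 * (f 0)^-1)) (is_derive_id r 1)))
    (is_derive_cmul c (is_derive_mul (is_derive_id r 1) (is_derive_id r 1))).
  apply: is_derive_eq; rewrite -(H2 r r01).
  by ring.
have -> : (f t)^-1 = (f 0)^-1 - 2 * (p 0 * (f 0)^-1) * t + c * (t * t).
  by move: H3; lra.
by rewrite /c; field.
Qed.

Let fE t : 0 <= t <= 1 -> f t = f 0 / ((1 - p 0 * t) ^+ 2 + K * (f 0 * t) ^+ 2).
Proof.
move=> t01; rewrite -Riccati_inverse//.
by field; rewrite ?(lt0r_neq0 (f_gt0 t01)) ?(lt0r_neq0 (f_gt0 i00)).
Qed.

Let D_gt0 t : 0 <= t <= 1 -> 0 < (1 - p 0 * t) ^+ 2 + K * (f 0 * t) ^+ 2.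
Proof. by move=> t01; rewrite -Riccati_inverse// mulr_gt0 ?invr_gt0 ?f_gt0. Qed.

Lemma primitive_flat : K = 0 -> exists A : R -> R,
  [/\ A 0 = 0, A 1 = f 0 / (1 - p 0) &
      forall t, 0 <= t <= 1 -> is_derive t 1 A (f t)].
(* Here [fE] reduces to [f 0 / (1 - p 0 * t) ^+ 2], which has a rational primitive. *)
Proof.
move=> K0; exists (fun t => f 0 * (t * (1 + - p 0 * t)^-1)).
split; rewrite ?mul0r ?mulr0 ?mulr1 ?mul1r// => t t01.
have d0 : 1 + - p 0 * t != 0.
  have := D_gt0 t01; rewrite K0 mul0r addr0 mulNr.
  by apply: contraTneq => ->; rewrite expr0n ltxx.
have H := is_derive_cmul (f 0) (is_derive_mul (is_derive_id t 1)
  (@is_derive_inv (fun s => 1 + - p 0 * s) _ t d0 (is_derive_lin1 1 (- p 0) t))).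
apply: is_derive_eq; rewrite [RHS]fE// K0 mul0r addr0 /=.
have d1 : 1 - p 0 * t != 0 by rewrite -mulNr.
by field; rewrite ?d0 ?d1.
Qed.

Lemma primitive_negative : K = -1 -> exists A : R -> R,
  [/\ A 0 = 0, A 1 = ln (Num.sqrt ((1 - p 0 + f 0) / (1 - p 0 - f 0))) &
      forall t, 0 <= t <= 1 -> is_derive t 1 A (f t)].
Proof.
move=> K1.
(* The quadratic splits over the reals, and partial fractions give the two logarithms. Its
   positivity makes each factor nonzero, so [linear_pos] makes each factor positive. *)
have fac t : (1 - p 0 * t) ^+ 2 + K * (f 0 * t) ^+ 2 =
    (1 - (p 0 - f 0) * t) * (1 - (p 0 + f 0) * t) by rewrite K1; ring.
have nz t : 0 <= t <= 1 -> (1 - (p 0 - f 0) * t != 0) && (1 - (p 0 + f 0) * t != 0).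
  by move=> /D_gt0; rewrite fac => /lt0r_neq0; rewrite mulf_eq0 negb_or.
have pos1 := linear_pos (fun t t01 => proj1 (andP (nz t t01))).
have pos2 := linear_pos (fun t t01 => proj2 (andP (nz t t01))).
exists (fun t => 2^-1 * (ln (1 + - (p 0 - f 0) * t) - ln (1 + - (p 0 + f 0) * t))).
split.
- by rewrite !mulr0 !addr0 ln1 subrr mulr0.
- have i11 : (0 : R) <= (1 : R) <= (1 : R) by rewrite ler01 lexx.
  have a0 := pos1 _ i11; have b0 := pos2 _ i11; rewrite !mulr1 in a0 b0 *.
  have -> : 1 + - (p 0 - f 0) = 1 - p 0 + f 0 by ring.
  have -> : 1 + - (p 0 + f 0) = 1 - p 0 - f 0 by ring.
  have {}a0 : 0 < 1 - p 0 + f 0 by move: a0; lra.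
  have {}b0 : 0 < 1 - p 0 - f 0 by move: b0; lra.
  rewrite -ln_div ?posrE//.
  set q := _ / _; have q0 : 0 < q by rewrite divr_gt0.
  have -> : ln q = ln (Num.sqrt q) *+ 2.
    by rewrite -lnXn ?sqrtr_gt0// sqr_sqrtr// ltW.
  by rewrite -[ln _ *+ 2]mulr_natl mulKf.
- move=> t t01; have a0 := pos1 _ t01; have b0 := pos2 _ t01.
  rewrite -mulNr in a0; rewrite -mulNr in b0.
  have D1 := @is_derive1_comp _ (@ln R) (fun s => 1 + - (p 0 - f 0) * s) t _ _
    (is_derive1_ln a0) (is_derive_lin1 1 (- (p 0 - f 0)) t).
  have D2 := @is_derive1_comp _ (@ln R) (fun s => 1 + - (p 0 + f 0) * s) t _ _
    (is_derive1_ln b0) (is_derive_lin1 1 (- (p 0 + f 0)) t).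
  have H := is_derive_cmul (2^-1) (is_derive_sub D1 D2).
  apply: is_derive_eq; rewrite [RHS]fE// fac -!mulNr.
  by field; rewrite ?lt0r_neq0.
Qed.

Lemma primitive_positive : K = 1 -> exists A : R -> R,
  [/\ A 0 = 0,
      A 1 = atan ((f 0 ^+ 2 + p 0 ^+ 2 - p 0) / f 0) + atan (p 0 / f 0) &
      forall t, 0 <= t <= 1 -> is_derive t 1 A (f t)].
Proof.
move=> K1; have f0 := lt0r_neq0 (f_gt0 i00).
(* Completing the square in the denominator gives the first arctangent; the constant normalizes the
   primitive at 0. The value at 1 is already the required sum, so no addition formula with its
   choice of branch is involved. *)
exists (fun t => atan (- p 0 / f 0 + (f 0 ^+ 2 + p 0 ^+ 2) / f 0 * t) + atan (p 0 / f 0)).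
split.
- by rewrite mulr0 addr0 mulNr atanN addNr.
- by rewrite mulr1 -mulrDl [- p 0 + _]addrC.
- move=> t t01.
  have D1 := @is_derive1_comp _ (@atan R)
    (fun s => - p 0 / f 0 + (f 0 ^+ 2 + p 0 ^+ 2) / f 0 * s) t _ _ (is_derive1_atan _)
    (is_derive_lin1 (- p 0 / f 0) ((f 0 ^+ 2 + p 0 ^+ 2) / f 0) t).
  have H := is_derive_add D1 (is_derive_cst (atan (p 0 / f 0)) t 1).
  apply: is_derive_eq; rewrite [RHS]fE// K1 addr0 mul1r.
  have Dp := D_gt0 t01; rewrite K1 mul1r in Dp.
  have E : 1 + (- p 0 / f 0 + (f 0 ^+ 2 + p 0 ^+ 2) / f 0 * t) ^+ 2 =
      (f 0 ^+ 2 + p 0 ^+ 2) / f 0 ^+ 2 * ((1 - p 0 * t) ^+ 2 + (f 0 * t) ^+ 2).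
    by field.
  rewrite E.
  have fp : f 0 ^+ 2 + p 0 ^+ 2 != 0.
    by rewrite gt_eqF// ltr_pwDl ?sqr_ge0// exprn_gt0// f_gt0.
  by move: Dp => /lt0r_neq0; move: (_ + (f 0 * t) ^+ 2) => D Dn; field; rewrite Dn fp f0.
Qed.

End Riccati.

(** * Calibration *)

Section Integrals.
Context {R : realType}.

Lemma FTC_segment (f G : R -> R) (a b : R) : a < b ->
  (forall t : R, a <= t <= b -> is_derive t 1 G (f t)) ->
  (forall t : R, a <= t <= b -> {for t, continuous f}) ->
  (\int[lebesgue_measure]_(x in `[a, b]) (f x)%:E = (G b)%:E - (G a)%:E)%E.
Proof.
move=> ab dG cf.
have cG (t : R) : a <= t <= b -> {for t, continuous G}.
  by move=> /dG[D _]; apply/differentiable_continuous/derivable1_diffP.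
apply: continuous_FTC2 => //.
- by apply: continuous_in_subspaceT => t; rewrite inE/= in_itv/=; exact: cf.
- split.
  + by move=> t /subset_itv_oo_cc; rewrite in_itv/= => /dG[].
  + by apply: cvg_at_right_filter; apply: cG; rewrite lexx ltW.
  + by apply: cvg_at_left_filter; apply: cG; rewrite lexx ltW.
- move=> t /subset_itv_oo_cc; rewrite in_itv/= => /dG[_ E].
  by rewrite derive1E.
Qed.

Lemma integrable_segment (f : R -> R) (a b : R) :
  (forall t : R, a <= t <= b -> {for t, continuous f}) ->
  lebesgue_measure.-integrable `[a, b] (EFin \o f).
Proof.
move=> cf; apply: continuous_compact_integrable; first exact: segment_compact.
by apply: continuous_in_subspaceT => t; rewrite inE/= in_itv/=; exact: cf.
Qed.

End Integrals.

(** * The Poincare lemma on a convex domain *)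

Section Poincare.
Context {R : realType} {n : nat}.
Local Notation vec := 'rV[R]_n.
Local Notation e i := (delta_mx 0 i : vec).
Variables (Omega : set vec) (w : 'I_n -> vec -> R) (a : vec).
Hypotheses (oO : open Omega) (Oa : Omega a).
Hypothesis convO : forall x y (t : R), Omega x -> Omega y -> 0 <= t <= 1 ->
  Omega (x + t *: (y - x)).
Hypothesis sw : forall i, smooth Omega (w i).
Hypothesis cw : forall i j x, Omega x -> 'D_(e j) (w i) x = 'D_(e i) (w j) x.

Let dw i x : Omega x -> differentiable (w i) x.
Proof.
move=> Ox; apply: rV_C1_differentiable Ox => [|v y|v y]; first exact: oO.
  exact: (smooth_derivable (sw i)).
exact: (smooth_continuous (smooth_derive v (sw i))).
Qed.

Let Dsum i x v : Omega x -> 'D_v (w i) x = \sum_j v 0 j * 'D_(e j) (w i) x.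
Proof. by move=> Ox; rewrite {1}[v]row_sum_delta derive_lin_sum//; exact: dw. Qed.

(** The line integral of the 1-form with components [w i] along the segment from [a] to [x]. *)
Definition potential (x : vec) : R :=
  (\int[lebesgue_measure]_(t in `[0, 1])
     \sum_i (x - a) 0 i * w i (a + t *: (x - a)))%R.

Let line_in (x : vec) (t : R) : Omega x -> 0 <= t <= 1 -> Omega (a + t *: (x - a)).
Proof. by move=> Ox; exact: convO. Qed.

Let cont_line (g : vec -> R) (y v : vec) (s t : R) :
  {for a + t *: (y + s *: v), continuous g} ->
  {for (s, t), continuous (fun z : R * R => g (a + z.2 *: (y + z.1 *: v)))}.
Proof.
move=> cg; apply: (@continuous_comp _ _ _ (fun z : R * R => a + z.2 *: (y + z.1 *: v)) g) => //.
apply: cvgD; first exact: cvg_cst.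
apply: cvgZ; first exact: cvg_snd.
by apply: cvgD; [exact: cvg_cst|apply: cvgZr_tmp; exact: cvg_fst].
Qed.

(** Differentiate under the integral sign along [x + s *: v]; [phi] is the integrand and [psi] its
    derivative in [s]. At [s = 0] closedness makes [psi] an exact derivative in [t]. *)
Lemma potential_derive x v : Omega x ->
  is_derive x v potential (\sum_i v 0 i * w i x).
Proof.
move=> Ox; pose y := x - a.
pose phi (s t : R) := \sum_i (y + s *: v) 0 i * w i (a + t *: (y + s *: v)).
pose psi (s t : R) := \sum_i ((y + s *: v) 0 i * (t * 'D_v (w i) (a + t *: (y + s *: v)))
  + w i (a + t *: (y + s *: v)) * v 0 i).
have [r r0 Or] : exists2 r : R, 0 < r & forall s : R, `|s| <= r -> Omega (x + s *: v).
  have C : (fun s : R => x + s *: v) @ (0 : R) --> x.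
    rewrite -[X in _ --> X]addr0 -(scale0r v).
    by apply: cvgD; [exact: cvg_cst|apply: cvgZr_tmp; exact: cvg_id].
  have N : \forall s \near (0 : R), Omega (x + s *: v).
    by apply: C; exact: open_nbhs_nbhs.
  have /nbhs_ballP[r /= r0 br] := N.
  exists (r / 2); first by rewrite divr_gt0.
  move=> s sr; apply: br; rewrite -ball_normE/= sub0r normrN.
  by apply: le_lt_trans sr _; move: r0; lra.
have ys (s : R) : y + s *: v = (x + s *: v) - a by rewrite /y addrAC.
have OW (s t : R) : `|s| <= r -> 0 <= t <= 1 -> Omega (a + t *: (y + s *: v)).
  by move=> /Or Os; rewrite ys; exact: line_in.
have dphi (s t : R) : `|s| <= r -> 0 <= t <= 1 -> is_derive s 1 (phi ^~ t) (psi s t).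
  move=> sr t01; have Dy := is_derive_affine y v s.
  have Dline : is_derive s 1 (fun s : R => a + t *: (y + s *: v)) (t *: v).
    have H := is_deriveD (is_derive_cst a s 1) (is_deriveZ t Dy).
    by apply: is_derive_eq; rewrite add0r.
  have DE i : is_derive s 1 (fun s : R => (y + s *: v) 0 i * w i (a + t *: (y + s *: v)))
      ((y + s *: v) 0 i * (t * 'D_v (w i) (a + t *: (y + s *: v)))
        + w i (a + t *: (y + s *: v)) * v 0 i).
    have D1 := is_derive_coord i Dy.
    have D2 := is_derive_curve (dw i (OW s t sr t01)) Dline.
    have H := is_deriveM D1 D2.
    apply: is_derive_eq; rewrite /GRing.scale/=; congr (_ * _ + _).
    have := @derive_linear _ _ (w i) _ t v 0 (dw i (OW s t sr t01)).
    by rewrite addr0 derive0 addr0.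
  have -> : phi ^~ t = \sum_(i < n) (fun s : R => (y + s *: v) 0 i * w i (a + t *: (y + s *: v))).
    by apply/funext => s'; rewrite fct_sumE.
  exact: is_derive_sum.
have cpsi (s t : R) : `|s| <= r -> 0 <= t <= 1 ->
    {for (s, t), continuous (fun z : R * R => psi z.1 z.2)}.
  move=> sr t01; apply: cvg_big => [|i _]; first exact: add_continuous.
  have cc : (fun z : R * R => (y + z.1 *: v) 0 i) @ (s, t) --> (y + s *: v) 0 i.
    apply: (@cvg_comp _ _ _ (fun z : R * R => y + z.1 *: v) (fun u : vec => u 0 i)
       _ (nbhs (y + s *: v))); last exact: coord_continuous.
    by apply: cvgD; [exact: cvg_cst|apply: cvgZr_tmp; exact: cvg_fst].
  apply: cvgD; last first.
    apply: cvgMr_tmp; apply: (@cont_line (w i)).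
    exact: smooth_continuous (sw i) (OW s t sr t01).
  apply: cvgM => //; apply: cvgM; first exact: cvg_snd.
  apply: (@cont_line ('D_v (w i))).
  exact: smooth_continuous (smooth_derive v (sw i)) (OW s t sr t01).
(* The dominating constant for differentiation under the integral: [psi] is continuous on a compact
   rectangle. *)
have [C C0 HC] : exists2 C : R, 0 <= C & forall s t : R, `|s| <= r -> 0 <= t <= 1 ->
    `|psi s t| <= C.
  have cK : compact (`[(- r), r] `*` `[(0 : R), 1]).
    by apply: compact_setX; exact: segment_compact.
  have cP : {within `[(- r), r] `*` `[(0 : R), 1], continuous (fun z : R * R => psi z.1 z.2)}.
    apply: continuous_in_subspaceT => -[s t]; rewrite inE => -[/=].
    by rewrite !in_itv/= -ler_norml => sr t01; exact: cpsi.
  have /compact_bounded[M [_ HM]] := continuous_compact cP cK.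
  exists (`|M| + 1); first by rewrite addr_ge0.
  move=> s t sr t01; apply: (HM (`|M| + 1)).
    by apply: le_lt_trans (ler_norm M) _; rewrite ltrDl.
  exists (s, t) => //; split; rewrite /= in_itv/=//.
  by rewrite -ler_norml.
have cphi (s t : R) : `|s| <= r -> 0 <= t <= 1 -> {for t, continuous (phi s)}.
  move=> sr t01; apply: cvg_big => [|i _]; first exact: add_continuous.
  apply: cvgMl_tmp; apply: (@continuous_comp _ _ _ (fun t : R => a + t *: (y + s *: v)) (w i)).
    by apply: cvgD; [exact: cvg_cst|apply: cvgZr_tmp; exact: cvg_id].
  exact: smooth_continuous (sw i) (OW s t sr t01).
have r00 : `]- r, r[%classic (0 : R) by rewrite /= in_itv/= oppr_lt0 r0.
have Ir (s : R) : `]- r, r[%classic s -> `|s| <= r.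
  by rewrite /= in_itv/= -ltr_norml => /ltW.
have I01 (t : R) : `[0, 1]%classic t -> 0 <= t <= 1 by rewrite /= in_itv.
have H1 (s : R) : `]- r, r[%classic s ->
    lebesgue_measure.-integrable `[0, 1] (EFin \o phi s).
  by move=> /Ir sr; apply: integrable_segment => t t01; exact: cphi.
have H2 (s t : R) : `]- r, r[%classic s -> `[0, 1]%classic t -> derivable (phi ^~ t) s 1.
  by move=> /Ir sr /I01 t01; have [] := dphi s t sr t01.
have H3 (s t : R) : `]- r, r[%classic s -> `[0, 1]%classic t ->
    `|partial1of2 phi s t| <= cst C t.
  move=> /Ir sr /I01 t01; have [_ E] := dphi s t sr t01.
  by rewrite partial1of2E E; exact: HC.
have IC : lebesgue_measure.-integrable `[(0 : R), 1] (EFin \o cst C).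
  by apply: integrable_segment => t _; exact: cst_continuous.
have m01 : measurable (`[0, 1] : set (measurableTypeR R)) by exact: measurable_itv.
have D := derivable_under_integral m01 r00 H1 H2 (fun=> C0) IC H3.
have DE := differentiation_under_integral m01 r00 H1 H2 (fun=> C0) IC H3.
have hphi (s : R) : potential (s *: v + x) =
    (\int[lebesgue_measure]_(t in `[0, 1]) phi s t)%R.
  by rewrite (addrC (s *: v) x) /potential -ys.
have Dv : derivable potential x v.
  by apply/derivable1P; under eq_fun do rewrite hphi.
apply: DeriveDef => //.
have -> : 'D_v potential x = 'D_1 (fun s : R => potential (x + s *: v)) 0.
  have := @is_derive_line _ _ _ potential x v 0.
  by rewrite scale0r addr0 => /(_ Dv)[_ ->].
under eq_fun => s do rewrite (addrC x (s *: v)) hphi.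
rewrite -derive1E DE /Rintegral.
(* The primitive of [psi 0]: exchanging the indices by [cw] turns the derivative of the form in
   direction [v], paired with [y], into the one in direction [y], paired with [v]. *)
pose G (t : R) := t * \sum_i v 0 i * w i (a + t *: y).
have y0 : y + (0 : R) *: v = y by rewrite scale0r addr0.
have Oy (t : R) : 0 <= t <= 1 -> Omega (a + t *: y) by exact: line_in.
have n0r : `|0 : R| <= r by rewrite normr0 ltW.
have -> : (\int[lebesgue_measure]_(x0 in `[0%R, 1%R]) (partial1of2 phi 0 x0)%:E)%E =
    (\int[lebesgue_measure]_(x0 in `[0%R, 1%R]) (psi 0 x0)%:E)%E.
  apply: eq_integral => t; rewrite inE => /I01 t01.
  by have [_ E] := dphi 0 t n0r t01; rewrite partial1of2E E.
have dG (t : R) : 0 <= t <= 1 -> is_derive t 1 G (psi 0 t).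
  move=> t01; have Ot := Oy t t01.
  have DS : is_derive t 1 (fun t : R => \sum_i v 0 i * w i (a + t *: y))
      (\sum_i v 0 i * 'D_y (w i) (a + t *: y)).
    have -> : (fun t : R => \sum_i v 0 i * w i (a + t *: y)) =
        \sum_(i < n) (fun t : R => v 0 i * w i (a + t *: y)).
      by apply/funext => s; rewrite fct_sumE.
    apply: is_derive_sum => i; apply: is_deriveZ.
    exact: is_derive_line (smooth_derivable (sw i) Ot).
  have H := is_deriveM (is_derive_id t 1) DS.
  apply: is_derive_eq; rewrite /GRing.scale/= mulr1 /psi y0 big_split/=.
  congr (_ + _); last by apply: eq_bigr => i _; rewrite mulrC.
  rewrite mulr_sumr.
  transitivity (\sum_i \sum_j t * (v 0 i * (y 0 j * 'D_(e j) (w i) (a + t *: y)))).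
    by apply: eq_bigr => i _; rewrite (Dsum _ _ Ot) !mulr_sumr.
  rewrite exchange_big; apply: eq_bigr => i _ /=.
  rewrite (Dsum _ _ Ot) !mulr_sumr; apply: eq_bigr => j _.
  by rewrite (cw i j Ot); ring.
rewrite (@FTC_segment _ (psi 0) G 0 1 ltr01 dG).
  by rewrite /G mul1r mul0r scale1r /y (addrC a) subrK sube0.
move=> t t01; have := cpsi 0 t n0r t01.
move=> c; apply: (@continuous_comp _ _ _ (fun t : R => ((0 : R), t)) (fun z => psi z.1 z.2)) => //.
by apply: continuous_pair; [exact: cst_continuous|exact: cvg_id].
Qed.

End Poincare.

Section SmoothSections.
Context {R : realType} {n : nat}.
Local Notation vec := 'rV[R]_n.

Lemma smooth_section (Omega : set vec) (g : vec * vec -> R) (w : vec) : w != 0 ->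
  smooth (slit Omega) g -> smooth Omega (fun x => g (x, w)).
Proof.
move=> w0 sg k; move: (sg k); elim: k g {sg} => [|k IH] g [cg Dg].
  split=> // x Ox; apply: (@continuous_comp _ _ _ (fun x' => (x', w)) g).
    by apply: continuous_pair; [exact: cvg_id|exact: cst_continuous].
  exact: cg.
split=> [x Ox|v].
  apply: (@continuous_comp _ _ _ (fun x' => (x', w)) g).
    by apply: continuous_pair; [exact: cvg_id|exact: cst_continuous].
  exact: cg.
have [dg Ckg] := Dg (horiz v).
have gE : unc (fun x y => g (x, y)) = g by apply/funext => -[].
split.
  move=> x Ox; apply: (@derivable_horiz _ _ (fun x y => g (x, y))).
  by rewrite gE; exact: dg.
have -> : 'D_v (fun x => g (x, w)) = fun x => 'D_(horiz v) g (x, w).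
  by apply/funext => x; rewrite (derive_horiz (fun x y => g (x, y))) gE.
exact: IH Ckg.
Qed.

Lemma smooth_affine_curve (W : normedModType R) (x w : W) :
  smooth setT (fun t : R => x + t *: w).
Proof.
have c (t : R) : {for t, continuous (fun t : R => x + t *: w)}.
  by apply: cvgD; [exact: cvg_cst|apply: cvgZr_tmp; exact: cvg_id].
case=> [|k]; first by split=> // t _; exact: c.
split=> [t _|v]; first exact: c.
have d (t : R) : differentiable (fun t : R => x + t *: w) t.
  by apply/derivable1_diffP; have [] := is_derive_affine x w t.
split=> [t _|]; first exact: diff_derivable.
have -> : 'D_v (fun t : R => x + t *: w) = (fun=> v *: w) :> (R -> W).
  apply/funext => t; rewrite deriveE// -[X in 'd _ _ X]mulr1 -[v * 1]/(v *: (1 : R)).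
  by rewrite linearZ -deriveE//; have [_ ->] := is_derive_affine x w t.
exact: Ck_cst.
Qed.

End SmoothSections.

(** * Lengths bounded below by increments of the potential *)

Section Calibration.
Context {R : realType} {n : nat}.
Local Notation vec := 'rV[R]_n.
Local Notation e i := (delta_mx 0 i : vec).
Variables (Omega : set vec) (F : vec -> vec -> R).
Hypotheses (oO : open Omega) (HF : finsler_metric Omega F).
Local Notation f := (unc F).
Local Notation Fs := (F_smooth HF).
Variables (w : vec) (h : vec -> R).
Hypothesis w0 : w != 0.
Hypothesis h_der : forall x v, Omega x -> is_derive x v h ('D_(vert v) f (x, w)).

Let om v (x : vec) := 'D_(vert v) f (x, w).

Let om_cont v x : Omega x -> {for x, continuous (om v)}.
Proof.
move=> Ox; exact: smooth_continuous (smooth_section w0 (smooth_derive (vert v) Fs)) Ox.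
Qed.

Let h_diff x : Omega x -> differentiable h x.
Proof.
move=> Ox; apply: rV_C1_differentiable Ox => [|v y|v y Oy]; first exact: oO.
  by move=> Oy; have [] := h_der v Oy.
have C0 : Ck 0 Omega (om v) := smooth_section w0 (smooth_derive (vert v) Fs) 0.
have [|+ _] := @Ck_ext _ _ 0 Omega (om v) ('D_v h) oO _ C0; last exact.
by move=> y' Oy'; have [_ ->] := h_der v Oy'.
Qed.

Lemma calibrated_curve (c : R -> vec) t c' : Omega (c t) -> is_derive t 1 c c' ->
  is_derive t 1 (h \o c) ('D_(vert c') f (c t, w)).
Proof.
move=> Oc Dc; have := is_derive_curve (h_diff Oc) Dc.
by have [_ ->] := h_der c' Oc.
Qed.

Let mu := @lebesgue_measure R.
Let phi (c : R -> vec) t := F (c t) (derive1 c t).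

(** Integrates the fundamental inequality: [k] is the derivative of [h] along [g] and is at most the
    speed [psi]. Measurability is part of the conclusion because gluing the pieces requires it. *)
Lemma calibrated_piece (c g : R -> vec) (a b : R) : a < b -> smooth setT g ->
  (forall t, a <= t <= b -> c t = g t) -> (forall t, a <= t <= b -> Omega (c t)) ->
  measurable_fun (`[a, b] : set (measurableTypeR R)) (phi c) /\
  ((h (c b) - h (c a))%:E <= \int[mu]_(t in `[a, b]) (phi c t)%:E)%E.
Proof.
move=> ab sg cg Oc.
have dg (t : R) : is_derive t 1 g ('D_1 g t).
  by apply: derivableP; have [_ /(_ 1)[+ _]] := sg 1%N; apply.
have cg1 (t : R) : {for t, continuous g}.
  by have [+ _] := sg 0%N; apply.
have cg2 (t : R) : {for t, continuous ('D_1 g)}.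
  by have [_ /(_ 1)[_ [+ _]]] := sg 1%N; apply.
have Og t : a <= t <= b -> Omega (g t) by move=> tab; rewrite -cg//; exact: Oc.
pose psi t := F (g t) ('D_1 g t).
pose k t := 'D_(vert ('D_1 g t)) f (g t, w).
have cpsi t : a <= t <= b -> {for t, continuous psi}.
  move=> tab; apply: (@continuous_comp _ _ _ (fun s => (g s, 'D_1 g s)) f).
    by apply: continuous_pair; [exact: cg1|exact: cg2].
  by apply: (F_continuous oO HF); exact: Og.
have ck t : a <= t <= b -> {for t, continuous k}.
  (* The direction of differentiation varies with time, so it is expanded in coordinates; this is
     legitimate only while [g] stays in [Omega], hence near [t]. *)
  move=> tab; pose k' s := \sum_i ('D_1 g s) 0 i * om (e i) (g s).
  have ck' : {for t, continuous k'}.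
    apply: cvg_big => [|i _]; first exact: add_continuous.
    apply: cvgM.
      apply: (@cvg_comp _ _ _ ('D_1 g) (fun u : vec => u 0 i) _ (nbhs ('D_1 g t))).
        exact: cg2.
      exact: coord_continuous.
    apply: (@continuous_comp _ _ _ g (om (e i))) => //.
    by apply: om_cont; exact: Og.
  have kE s : Omega (g s) -> k s = k' s.
    by move=> Os; rewrite /k (derive_vert_sum oO Fs (slitP Os w0)).
  rewrite /prop_for /continuous_at kE; last exact: Og.
  apply: cvg_trans ck'; apply: near_eq_cvg.
  have : \forall s \near t, Omega (g s).
    by apply: cg1; apply: open_nbhs_nbhs; split => //; exact: Og.
  by apply: filterS => s /kE.
(* At a break point [c] may fail to be differentiable although [g] is, so the integrands are
   compared on the open interval; the endpoints are a null set. *)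
have phiE t : `]a, b[%classic t -> phi c t = psi t.
  move=> tab'; have tab : a <= t <= b by have := subset_itv_oo_cc tab'; rewrite /= in_itv.
  rewrite /phi /psi cg// derive1E; congr (F _ _); apply: near_eq_derive.
  have : nbhs t `]a, b[%classic by apply: open_nbhs_nbhs; split => //; exact: itv_open.
  by apply: filterS => s /subset_itv_oo_cc; rewrite /= in_itv/= => /cg.
have mpsi : measurable_fun (`]a, b[ : set (measurableTypeR R)) psi.
  apply: open_continuous_measurable_fun; first exact: itv_open.
  move=> t; rewrite inE => tab.
  by apply: cpsi; have := subset_itv_oo_cc tab; rewrite /= in_itv.
have mphi : measurable_fun (`]a, b[ : set (measurableTypeR R)) (phi c).
  by apply: eq_measurable_fun mpsi => t; rewrite inE => /phiE.
split; first exact: measurable_fun_itv_cc mphi.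
have -> : (\int[mu]_(t in `[a, b]) (phi c t)%:E = \int[mu]_(t in `[a, b]) (psi t)%:E)%E.
  rewrite integral_itv_bndoo; last exact/measurable_EFinP.
  rewrite [RHS]integral_itv_bndoo; last exact/measurable_EFinP.
  by apply: eq_integral => t; rewrite inE => /phiE ->.
have dh t : a <= t <= b -> is_derive t 1 (h \o g) (k t).
  by move=> tab; apply: calibrated_curve => //; exact: Og.
have cb : c b = g b by apply: cg; rewrite lexx ltW.
have ca : c a = g a by apply: cg; rewrite lexx ltW.
rewrite cb ca EFinB -[X in (X <= _)%E](@FTC_segment _ k (h \o g) a b ab dh ck).
apply: le_integral; [exact: measurable_itv|exact: (integrable_segment ck)|
  exact: (integrable_segment cpsi)|].
move=> t; rewrite inE/= in_itv/= => tab; rewrite lee_fin.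
by apply: (fundamental_inequality oO HF) => //; exact: Og.
Qed.

(** Induction on the partition with a variable left end: the increments of [h] telescope and the
    integrals add up. *)
Lemma calibrated_partition (c : R -> vec) (s : seq R) (a b : R) :
  itv_partition a b s ->
  (forall i, (i < size s)%N -> exists2 g : R -> vec, smooth setT g &
    forall t, t \in `[nth 0 (a :: s) i, nth 0 s i] -> c t = g t) ->
  (forall t, a <= t <= b -> Omega (c t)) ->
  measurable_fun (`[a, b] : set (measurableTypeR R)) (phi c) /\
  ((h (c b) - h (c a))%:E <= \int[mu]_(t in `[a, b]) (phi c t)%:E)%E.
Proof.
elim: s a => [|x s IH] a part pw Oc.
  rewrite -(itv_partition_nil part) set_itv1; split; first exact: measurable_fun_set1.
  by rewrite subrr integral_set1.
have ax : a < x by case: part => /= /andP[].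
have part' := itv_partition_cons part.
have xb : x <= b := itv_partition_le part'.
have [g sg cg] := pw 0%N isT.
have Oc1 t : a <= t <= x -> Omega (c t).
  by move=> /andP[at_ tx]; apply: Oc; rewrite at_ (le_trans tx).
have Oc2 t : x <= t <= b -> Omega (c t).
  by move=> /andP[xt tb]; apply: Oc; rewrite tb andbT (le_trans (ltW ax)).
have [m1 I1] := calibrated_piece ax sg (fun t tab => cg t tab) Oc1.
have [m2 I2] := IH x part' (fun i si => pw i.+1 si) Oc2.
have U12 : `[a, b]%classic = (`[a, x] `|` `]x, b])%classic :> set R.
  by rewrite -itv_bndbnd_setU// bnd_simp ltW.
have m2' : measurable_fun (`]x, b] : set (measurableTypeR R)) (phi c).
  by apply: measurable_funS m2 => //; exact: subset_itv_oc_cc.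
have m12 : measurable_fun (`[a, b] : set (measurableTypeR R)) (phi c).
  by rewrite U12; apply/measurable_funU => //; exact: measurable_itv.
split=> //.
rewrite U12 ge0_integral_setU; first last.
- apply/disj_setPS => t [] /=; rewrite !in_itv/= => /andP[_ tx] /andP[xt _].
  by have := lt_le_trans xt tx; rewrite ltxx.
- rewrite -U12 => t /=; rewrite in_itv/= => tab; rewrite lee_fin.
  by rewrite (F_ge0 HF)//; exact: Oc.
- by rewrite -U12; exact/measurable_EFinP.
- exact: measurable_itv.
- exact: measurable_itv.
rewrite [X in (_ + X)%E]integral_itv_obnd_cbnd; last exact/measurable_EFinP.
have -> : h (c b) - h (c a) = (h (c x) - h (c a)) + (h (c b) - h (c x)).
  by rewrite [RHS]addrC addrA subrK.
by rewrite EFinD; apply: leeD.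
Qed.

Lemma calibrated_length (c : R -> vec) : piecewise_smooth c ->
  (forall t, t \in `[0, 1] -> Omega (c t)) ->
  ((h (c 1) - h (c 0))%:E <= curve_length F c)%E.
Proof.
move=> [s part pw] Oc.
by have [] := calibrated_partition part pw (fun t t01 => Oc t t01).
Qed.

End Calibration.

Lemma strictly_convex_segment {R : realType} {n : nat} (Omega : set 'rV[R]_n) :
  strictly_convex Omega -> forall x y (t : R), Omega x -> Omega y -> 0 <= t <= 1 ->
  Omega (x + t *: (y - x)).
Proof.
move=> sc x y t Ox Oy /andP[t0 t1].
have [->|xy] := eqVneq x y; first by rewrite subrr scaler0 addr0.
move: t0; rewrite le_eqVlt => /predU1P[<-|t0]; first by rewrite scale0r addr0.
move: t1; rewrite le_eqVlt => /predU1P[->|t1].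
  by rewrite scale1r addrC subrK.
have -> : x + t *: (y - x) = (1 - t) *: x + t *: y.
  by rewrite scalerBr scalerBl scale1r addrCA addrC.
apply: interior_subset; apply: (sc x y) => //; last by rewrite t0.
all: exact: subset_closure.
Qed.

Transparent horiz.

Lemma horiz_line {R : realType} {n : nat} (x w : 'rV[R]_n) (t : R) :
  (x, w) + t *: horiz w = (x + t *: w, w).
Proof.
have -> : (x, w) + t *: horiz w = (x + t *: w, w + t *: 0) by [].
by rewrite scaler0 addr0.
Qed.

Opaque horiz.

(** * The distance as the integral of the speed along the segment *)

Section Distance.
Context {R : realType} {n : nat}.
Local Notation vec := 'rV[R]_n.
Local Notation e i := (delta_mx 0 i : vec).
Variables (Omega : set vec) (F : vec -> vec -> R).
Hypotheses (oO : open Omega) (HF : finsler_metric Omega F).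
Hypothesis convO : strictly_convex Omega.
Hypothesis flat : projectively_flat Omega F.
Local Notation f := (unc F).
Local Notation Fs := (F_smooth HF).
Variables (x1 x2 : vec).
Hypotheses (O1 : Omega x1) (O2 : Omega x2) (x12 : x1 != x2).

Let w := x2 - x1.

Let w0 : w != 0.
Proof. by rewrite subr_eq0 eq_sym. Qed.

Let radial x y : Omega x -> y != 0 -> exists l, spray_vec F x y = l *: y.
Proof. by move=> Ox y0; exact: (flat_radial oO HF flat Ox y0). Qed.

Let segment_in (t : R) : 0 <= t <= 1 -> Omega (x1 + t *: w).
Proof. exact: strictly_convex_segment. Qed.

Let wi i (x : vec) := 'D_(vert (e i)) f (x, w).

Let swi i : smooth Omega (wi i).
Proof. exact: smooth_section w0 (smooth_derive (vert (e i)) Fs). Qed.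

Let D_section (g : vec * vec -> R) (v x : vec) :
  'D_v (fun x' => g (x', w)) x = 'D_(horiz v) g (x, w).
Proof.
have gE : unc (fun x y => g (x, y)) = g by apply/funext => -[].
by rewrite (derive_horiz (fun x y => g (x, y))) gE.
Qed.

Let closed_wi i j x : Omega x -> 'D_(e j) (wi i) x = 'D_(e i) (wi j) x.
Proof.
move=> Ox; apply: etrans (D_section ('D_(vert (e i)) f) (e j) x) _.
apply: etrans (Hamel_closed oO HF radial (e j) (e i) (slitP Ox w0)) _.
exact: esym (D_section ('D_(vert (e j)) f) (e i) x).
Qed.

Let h := potential wi x1.

Let h_der x v : Omega x -> is_derive x v h ('D_(vert v) f (x, w)).
Proof.
move=> Ox; rewrite (derive_vert_sum oO Fs (slitP Ox w0)).
exact: (potential_derive oO O1 (strictly_convex_segment convO) swi closed_wi v Ox).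
Qed.

Let line_der (g : vec * vec -> R) (t : R) : smooth (slit Omega) g -> 0 <= t <= 1 ->
  is_derive t 1 (fun s => g (x1 + s *: w, w)) ('D_(horiz w) g (x1 + t *: w, w)).
Proof.
move=> sg t01.
have D : derivable g ((x1, w) + t *: horiz w) (horiz w).
  rewrite horiz_line; apply: (smooth_derivable sg).
  by apply: slitP => //; exact: segment_in.
have := is_derive_line D; rewrite horiz_line.
have -> // : (fun s : R => g ((x1, w) + s *: horiz w)) = fun s => g (x1 + s *: w, w).
by apply/funext => s; rewrite horiz_line.
Qed.

Let speed (t : R) := F (x1 + t *: w) w.
Let factor (t : R) := pfac F (x1 + t *: w, w).

Lemma speed_gt0 (t : R) : 0 <= t <= 1 -> 0 < speed t.
Proof. by move=> t01; apply: (F_gt0 HF) => //; exact: segment_in. Qed.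

Lemma speed_der (t : R) : 0 <= t <= 1 -> is_derive t 1 speed (2 * factor t * speed t).
Proof.
move=> t01; have := line_der Fs t01.
have := projective_factorE oO HF (segment_in t01) w0.
rewrite -pfacE -/(factor t) -/(speed t).
move: ('D_(horiz w) f (x1 + t *: w, w)) => d pE.
suff -> : d = 2 * factor t * speed t by [].
rewrite pE [RHS]mulrAC [RHS]mulrC divfK//.
by rewrite mulf_neq0// ?pnatr_eq0// gt_eqF// speed_gt0.
Qed.

Lemma factor_der K (t : R) : (2 <= n)%N -> constant_flag_curvature Omega F K ->
  0 <= t <= 1 -> is_derive t 1 factor (factor t ^+ 2 - K * speed t ^+ 2).
Proof.
move=> n2 cK t01; have := line_der (smooth_pfac oO HF) t01.
have := flag_curvature_pfac oO HF radial n2 cK (segment_in t01) w0.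
rewrite -/(factor t) -/(speed t).
move: ('D_(horiz w) _ (x1 + t *: w, w)) => d <-.
by rewrite opprB addrC subrK.
Qed.

(** The segment itself is an admissible curve and gives the upper bound; the calibration gives the
    same number as a lower bound for every competitor. *)
Lemma dist_primitive (A : R -> R) :
  (forall t : R, 0 <= t <= 1 -> is_derive t 1 A (speed t)) ->
  finsler_dist Omega F x1 x2 = (A 1 - A 0)%:E.
Proof.
move=> dA.
have c0 : x1 + 0 *: w = x1 by rewrite scale0r addr0.
have c1 : x1 + 1 *: w = x2 by rewrite scale1r addrC subrK.
have i1 : (0 : R) <= (1 : R) <= (1 : R) by apply/andP; split; [exact: ler01|exact: lexx].
(* By Euler's identity the form at [w] evaluated on [w] is the speed, so [h] along the segment and
   [A] have the same derivative. *)
have hA : h x2 - h x1 = A 1 - A 0.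
  pose g (t : R) := h (x1 + t *: w) - A t.
  have dg (t : R) : 0 <= t <= 1 -> is_derive t 1 g 0.
    move=> t01; have Ot := segment_in t01.
    have D := calibrated_curve oO HF w0 h_der Ot (is_derive_affine x1 w t).
    rewrite (Euler_F HF Ot w0) in D.
    have := is_derive_sub D (dA t t01).
    by rewrite -/(speed t) subrr.
  have := eq_of_derive0 dg i1; rewrite /g c0 c1.
  by move=> E; move: (h x1) (h x2) (A 0) (A 1) E => a b a0 a1 E; lra.
apply/eqP; rewrite eq_le; apply/andP; split.
  apply: ge_ereal_inf; exists (A 1 - A 0)%:E => //=.
  exists (fun t : R => x1 + t *: w).
    split=> //.
    exists [:: 1]; first exact: itv_partition1.
    by case=> // _; exists (fun t : R => x1 + t *: w) => //; exact: smooth_affine_curve.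
  rewrite EFinB -(@FTC_segment _ speed A 0 1 ltr01 dA).
    apply: eq_integral => t _; rewrite /speed derive1E.
    by have [_ ->] := is_derive_affine x1 w t.
  move=> t t01; have [D _] := speed_der t01.
  exact/differentiable_continuous/derivable1_diffP.
apply: le_ereal_inf_tmp => _ [c [pc Oc cx1 cx2] <-].
by rewrite -hA -cx1 -cx2; exact: (calibrated_length oO HF w0 h_der pc Oc).
Qed.

End Distance.

Theorem theorem1p1 (R : realType) (n : nat) (n_ge2 : (2 <= n)%N)
    (Omega : set 'rV[R]_n) (F : 'rV[R]_n -> 'rV[R]_n -> R) (K : R)
    (Omega_open : open Omega) (Omega_connected : connected Omega)
    (Omega_convex : strictly_convex Omega) (Omega0 : Omega 0)
    (F_finsler : finsler_metric Omega F)
    (F_flat : projectively_flat Omega F)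
    (F_curv : constant_flag_curvature Omega F K)
    (x1 x2 : 'rV[R]_n) (Omega_x1 : Omega x1) (Omega_x2 : Omega x2)
    (x1_neq_x2 : x1 != x2) :
  let f := F x1 (x2 - x1) in
  let p := projective_factor F x1 (x2 - x1) in
  [/\ K = 0 -> finsler_dist Omega F x1 x2 = (f / (1 - p))%:E,
      K = -1 -> finsler_dist Omega F x1 x2 =
        (ln (Num.sqrt ((1 - p + f) / (1 - p - f))))%:E &
      K = 1 -> finsler_dist Omega F x1 x2 =
        (atan ((f ^+ 2 + p ^+ 2 - p) / f) + atan (p / f))%:E].
Proof.
move=> f p; set w := x2 - x1.
have f0 : F (x1 + 0 *: w) w = f by rewrite scale0r addr0.
have p0 : pfac F (x1 + 0 *: w, w) = p by rewrite scale0r addr0 pfacE.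
have fgt := speed_gt0 F_finsler Omega_convex Omega_x1 Omega_x2 x1_neq_x2.
have df := speed_der Omega_open F_finsler Omega_convex Omega_x1 Omega_x2 x1_neq_x2.
have dp t := @factor_der _ _ _ _ Omega_open F_finsler Omega_convex F_flat _ _
  Omega_x1 Omega_x2 x1_neq_x2 K t n_ge2 F_curv.
have dist := dist_primitive Omega_open F_finsler Omega_convex F_flat
  Omega_x1 Omega_x2 x1_neq_x2.
split=> KE.
- have [A [A0 A1 dA]] := primitive_flat fgt df dp KE.
  by rewrite (dist A dA) A0 A1 subr0 f0 p0.
- have [A [A0 A1 dA]] := primitive_negative fgt df dp KE.
  by rewrite (dist A dA) A0 A1 subr0 f0 p0.
- have [A [A0 A1 dA]] := primitive_positive fgt df dp KE.
  by rewrite (dist A dA) A0 A1 subr0 f0 p0.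
Qed.
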